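(* Let $n\ge 2$, $1\le p<n$, and $1\le q<\infty$. Then for any open set $G\subset \mathbb{R}^n$, $$\lim_{\alpha\to 1-0}(1-\alpha)^{p/q}\,\operatorname{cap}\left(G;B_{p,q}^\alpha\right)=\left(\frac1q\right)^{p/q}\operatorname{cap}(G;W_p^1).$$
   Context: Here $\|\cdot\|_p$ is the norm of $L^p(\mathbb{R}^n)$, $e_k$ is the $k$th unit coordinate vector, and $D_kf=\partial f/\partial x_k$. For $f\in L^p(\mathbb{R}^n)$, $1\le p<\infty$, the partial modulus of continuity is $$\omega_k(f;\delta)_p=\sup_{0\le h\le\delta}\left(\int_{\mathbb{R}^n}|f(x+he_k)-f(x)|^p\,dx\right)^{1/p}.$$ For $0<\alpha<1$, $1\le p,q<\infty$, $$\|f\|_{b^\alpha_{p,q;k}}=\left(\int_0^\infty\left(t^{-\alpha}\omega_k(f;t)_p\right)^q\frac{dt}{t}\right)^{1/q},\qquad \|f\|_{b^\alpha_{p,q}}=\sum_{k=1}^n\|f\|_{b^\alpha_{p,q;k}}.$$ For a compact set $K\subset\mathbb{R}^n$, let $\mathfrak{N}(K)$ be the set of all $f\in C_0^\infty(\mathbb{R}^n)$ (smooth, compactly supported) such that $f(x)\ge1$ for all $x\in K$. Define $$\operatorname{cap}(K;W_p^1)=\inf\left\{\left(\sum_{k=1}^n\|D_kf\|_p\right)^p: f\in\mathfrak{N}(K)\right\},\qquad \operatorname{cap}(K;B_{p,q}^\alpha)=\inf\left\{\|f\|_{b^\alpha_{p,q}}^p: f\in\mathfrak{N}(K)\right\}.$$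 For an open set $G\subset\mathbb{R}^n$ and $X=W_p^1$ or $X=B_{p,q}^\alpha$, $\operatorname{cap}(G;X)=\sup\{\operatorname{cap}(K;X):K\subset G,\ K\text{ compact}\}$ (possibly $+\infty$). *)

(* Defs.v *)
From HB Require Import structures.
From mathcomp Require Import all_boot all_order all_algebra.
From mathcomp Require Import all_classical all_reals all_analysis.
Set Implicit Arguments.
Unset Strict Implicit.
Unset Printing Implicit Defensive.
Import Order.TTheory GRing.Theory Num.Theory.
Import numFieldNormedType.Exports.
Local Open Scope classical_set_scope.
Local Open Scope ring_scope.

(* The sigma-algebra is generated by the coordinate maps, as the library does
   for tuples; since R is second countable it is the Borel sigma-algebra. *)
Definition rV_display : measure_display. Proof. by constructor. Qed.

Section measurable_rV.
Context {R : realType} (n : nat).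

Let coors : 'I_n -> 'rV[R]_n -> measurableTypeR R := fun i x => x ord0 i.

Let rV_set0 : g_sigma_preimage coors set0.
Proof. exact: sigma_algebra0. Qed.

Let rV_setC A : g_sigma_preimage coors A -> g_sigma_preimage coors (~` A).
Proof. exact: sigma_algebraC. Qed.

Let rV_bigcup (F : (set 'rV[R]_n)^nat) :
  (forall i, g_sigma_preimage coors (F i)) ->
  g_sigma_preimage coors (\bigcup_i F i).
Proof. exact: sigma_algebra_bigcup. Qed.

HB.instance Definition _ := @isMeasurable.Build rV_display
  'rV[R]_n (g_sigma_preimage coors) rV_set0 rV_setC rV_bigcup.

Lemma measurable_coord (i : 'I_n) :
  measurable_fun [set: 'rV[R]_n]
    ((fun x => x ord0 i) : 'rV[R]_n -> measurableTypeR R).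
Proof.
move=> _ Y mY; rewrite setTI; apply: sub_sigma_algebra => /=.
rewrite -bigcup_seq/=; exists i => /=; first by rewrite mem_index_enum.
by exists Y => //; rewrite setTI.
Qed.

Lemma measurable_fun_rV d (T : measurableType d) (f : T -> 'rV[R]_n) :
  (forall i, measurable_fun setT
    ((fun t => f t ord0 i) : T -> measurableTypeR R)) ->
  measurable_fun setT f.
Proof.
move=> mf; pose S := [set B : set 'rV[R]_n | d.-measurable (f @^-1` B)].
have sS : sigma_algebra setT S.
  split; rewrite /S /=.
  - by rewrite preimage_set0.
  - by move=> A mA; rewrite setTD preimage_setC; exact: measurableC.
  - by move=> F mF; rewrite preimage_bigcup; exact: bigcup_measurable.
move=> _ Y mY; rewrite setTI; move: Y mY; apply: smallest_sub => // B.
rewrite -bigcup_seq/= => -[i _ [C mC <-]]; rewrite /S /= setTI.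
by have := mf i measurableT C mC; rewrite setTI.
Qed.

End measurable_rV.

Section lebesgue_rV_step.
Context {R : realType} (n : nat).

Definition rV_cons (xv : measurableTypeR R * 'rV[R]_n) : 'rV[R]_n.+1 :=
  row_mx (xv.1)%:M xv.2.

Lemma rV_cons0 xv : rV_cons xv ord0 ord0 = xv.1.
Proof.
transitivity (rV_cons xv ord0 (lshift n (ord0 : 'I_1))).
  by congr (fun_of_matrix _ _ _); exact/val_inj.
by apply: etrans (row_mxEl _ _ _ _) _; rewrite mxE eqxx mulr1n.
Qed.

Lemma rV_consS xv (i : 'I_n) : rV_cons xv ord0 (lift ord0 i) = xv.2 ord0 i.
Proof.
transitivity (rV_cons xv ord0 (rshift 1 i)).
  by congr (fun_of_matrix _ _ _); exact/val_inj.
exact: (row_mxEr (xv.1)%:M).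
Qed.

Lemma measurable_rV_cons : measurable_fun setT rV_cons.
Proof.
apply: measurable_fun_rV => i; case: (unliftP ord0 i) => [j|] ->.
- rewrite (_ : (fun t => _) = (fun v : 'rV[R]_n => v ord0 j) \o snd).
    by apply: measurableT_comp; [exact: measurable_coord|exact: measurable_snd].
  by apply/funext => t /=; rewrite rV_consS.
- rewrite (_ : (fun t => _) = fst); first exact: measurable_fst.
  by apply/funext => t /=; rewrite rV_cons0.
Qed.

HB.instance Definition _ := isMeasurableFun.Build _ _ _ _ rV_cons
  measurable_rV_cons.

Definition rV_uncons (v : 'rV[R]_n.+1) : measurableTypeR R * 'rV[R]_n :=
  (v ord0 ord0, \row_i v ord0 (lift ord0 i)).

Lemma rV_consK : cancel rV_cons rV_uncons.
Proof.
move=> xv; rewrite /rV_uncons rV_cons0 [RHS]surjective_pairing.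
by congr pair; apply/rowP => i; rewrite mxE rV_consS.
Qed.

Lemma measurable_rV_uncons : measurable_fun setT rV_uncons.
Proof.
apply/measurable_fun_pairP; split; first exact: measurable_coord.
apply: measurable_fun_rV => i.
rewrite (_ : (fun t => _) = (fun v : 'rV[R]_n.+1 => v ord0 (lift ord0 i))).
  exact: measurable_coord.
by apply/funext => v /=; rewrite mxE.
Qed.

Variable mu : {sigma_finite_measure set 'rV[R]_n -> \bar R}.

(* image of the product measure dx dmu(v) under (x, v) |-> (x, v_1, ..., v_n) *)
Definition lebesgue_rVS : set 'rV[R]_n.+1 -> \bar R :=
  pushforward ((@lebesgue_measure R) \x mu)%E rV_cons.

Let lebesgue_rVS0 : lebesgue_rVS set0 = 0%E.
Proof. exact: measure0. Qed.

Let lebesgue_rVS_ge0 A : (0 <= lebesgue_rVS A)%E.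
Proof. exact: measure_ge0. Qed.

Let lebesgue_rVS_sigma_additive : semi_sigma_additive lebesgue_rVS.
Proof. exact: measure_semi_sigma_additive. Qed.

HB.instance Definition _ := isMeasure.Build _ _ _ lebesgue_rVS
  lebesgue_rVS0 lebesgue_rVS_ge0 lebesgue_rVS_sigma_additive.

Lemma lebesgue_rVS_uncons A :
  lebesgue_rVS (rV_uncons @^-1` A) = ((@lebesgue_measure R) \x mu)%E A.
Proof.
by rewrite /lebesgue_rVS /pushforward -comp_preimage
  (_ : rV_uncons \o rV_cons = id) // funeqE => x; exact: rV_consK.
Qed.

Let lebesgue_rVS_sigma_finite : sigma_finite setT lebesgue_rVS.
Proof.
have /sigma_finiteP[F [FT ndF mF]] := sigma_finiteT (@lebesgue_measure R).
have /sigma_finiteP[H [HT ndH mH]] := sigma_finiteT mu.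
exists (fun i => rV_uncons @^-1` (F i `*` H i)) => [|i].
  rewrite -preimage_bigcup (_ : \bigcup_i _ = setT) ?preimage_setT //.
  apply/seteqP; split=> // -[x y] _.
  have [i _ Fx] : (\bigcup_i F i) x by rewrite -FT.
  have [j _ Hy] : (\bigcup_i H i) y by rewrite -HT.
  exists (maxn i j) => //; split=> /=.
  - by move: x Fx; exact/subsetPset/ndF/leq_maxl.
  - by move: y Hy; exact/subsetPset/ndH/leq_maxr.
have [mFi Fi] := mF i; have [mHi Hi] := mH i; split.
  rewrite -[X in measurable X]setTI.
  by apply: measurable_rV_uncons => //; exact: measurableX.
rewrite lebesgue_rVS_uncons product_measure1E //.
by rewrite lte_mul_pinfty // ge0_fin_numE.
Qed.

HB.instance Definition _ := Measure_isSigmaFinite.Build _ _ _ lebesgue_rVS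
  lebesgue_rVS_sigma_finite.

End lebesgue_rV_step.

Fixpoint lebesgue_rV (R : realType) (n : nat) :
    {sigma_finite_measure set 'rV[R]_n -> \bar R} :=
  match n with
  | 0 => \d_(0 : 'rV[R]_0)
  | m.+1 => lebesgue_rVS (lebesgue_rV R m)
  end.

Lemma lebesgue_rV_box (R : realType) (n : nat)
    (A : 'I_n -> set (measurableTypeR R)) :
  (forall i, measurable (A i)) ->
  lebesgue_rV R n [set v : 'rV[R]_n | forall i, A i (v ord0 i)] =
  (\prod_(i < n) (@lebesgue_measure R) (A i))%E.
Proof.
elim: n A => [|n IH] A mA.
  by rewrite big_ord0 /= diracE mem_set // => -[].
have mB : measurable
    [set v : 'rV[R]_n | forall i, A (lift ord0 i) (v ord0 i)].
  rewrite (_ : [set v | _] = \bigcap_(i in [set: 'I_n])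
      ((fun v : 'rV[R]_n => v ord0 i) @^-1` A (lift ord0 i))); last first.
    by apply/seteqP; split=> v h i; [move=> _|]; exact: h.
  apply: fin_bigcap_measurable; first exact: finite_finset.
  move=> i _; rewrite -[X in measurable X]setTI.
  exact: measurable_coord.
rewrite big_ord_recl -IH // -product_measure1E // -lebesgue_rVS_uncons.
congr (lebesgue_rVS _ _); apply/seteqP; split=> v /=.
  by move=> h; split=> // i; rewrite mxE.
move=> [h0 h] i; case: (unliftP ord0 i) => [j|] -> //.
by have := h j; rewrite mxE.
Qed.

Section capacities.
Context {R : realType} {n : nat}.
Implicit Types (f : 'rV[R]_n -> R) (k : 'I_n) (K G : set 'rV[R]_n).
Implicit Types (alpha p q h t delta : R).

Definition unit_vec k : 'rV[R]_n := delta_mx ord0 k.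

Definition partial k f : 'rV[R]_n -> R := fun x => 'D_(unit_vec k) f x.

Definition iter_partial (s : seq 'I_n) f := foldr partial f s.

(* C^oo: the partial derivatives of all orders exist and are continuous
   everywhere ('D_v is a total operator, hence the derivability clause). *)
Definition smooth f := forall s : seq 'I_n,
  continuous (iter_partial s f) /\
  forall k x, derivable (iter_partial s f) x (unit_vec k).

Definition compactly_supported f := compact (closure [set x | f x != 0]).

Definition norm_Lp p f : \bar R := 'N[lebesgue_rV R n]_(p%:E)[EFin \o f]%E.

Definition modulus k f delta p : \bar R :=
  ereal_sup [set norm_Lp p (fun x => f (x + h *: unit_vec k) - f x) |
              h in [set h | 0 <= h <= delta]].

Definition besov_partial alpha p q k f : \bar R :=
  ((\int[@lebesgue_measure R]_(t in `]0%R, +oo[)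
      (((t `^ (- alpha))%:E * modulus k f t p) `^ q * (t^-1)%:E)) `^ q^-1)%E.

Definition besov_seminorm alpha p q f : \bar R :=
  (\sum_(k < n) besov_partial alpha p q k f)%E.

Definition sobolev_seminorm p f : \bar R :=
  (\sum_(k < n) norm_Lp p (partial k f))%E.

Definition admissible K : set ('rV[R]_n -> R) :=
  [set f | [/\ smooth f, compactly_supported f & forall x, K x -> 1 <= f x]].

Definition cap_compact p (N : ('rV[R]_n -> R) -> \bar R) K : \bar R :=
  ereal_inf [set (N f `^ p)%E | f in admissible K].

Definition cap_open p (N : ('rV[R]_n -> R) -> \bar R) G : \bar R :=
  ereal_sup [set cap_compact p N K | K in [set K | compact K /\ K `<=` G]].

Definition capW p G := cap_open p (sobolev_seminorm p) G.

Definition capB alpha p q G := cap_open p (besov_seminorm alpha p q) G.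

End capacities.

(* Main.v *)
From HB Require Import structures.
Require Import Defs.
From mathcomp Require Import all_boot all_order all_algebra.
From mathcomp Require Import all_classical all_reals all_analysis.
From mathcomp Require Import measurable_realfun lebesgue_integral_under.
From mathcomp Require Import ring lra.
Set Implicit Arguments.
Unset Strict Implicit.
Unset Printing Implicit Defensive.
Import Order.TTheory GRing.Theory Num.Theory.
Import numFieldNormedType.Exports.
Local Open Scope classical_set_scope.
Local Open Scope ring_scope.

(** Write omega_k(f;t) for the partial modulus of continuity in L^p and
    a = (1 - alpha) q.  Two elementary facts link it to derivatives: for a test
    function f, omega_k(f;t) <= t ||D_k f||_p, and the Steklov average
    S f(x) = int_0^1 f(x + s h e_k) ds satisfies
    h D_k (S f)(x) = f(x + h e_k) - f(x).  Both capacities are compared by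
    turning an admissible function for one of them into an admissible function
    for the other.

    Lower bound.  Let K be compact in G and let delta > 0 be such that
    K' = K + [0, delta]^n is still contained in G.  If f is admissible for K',
    then, because int_0^delta t^(a - 1) dt = delta^a / a, for every k some
    positive h_k <= delta makes omega_k(f; h_k) / h_k essentially at most
    (a / delta^a)^(1/q) times the k-th Besov seminorm of f
    ([besov_partial_small_diff]).  Averaging f successively over the segments
    [0, h_k e_k] gives a function admissible for K with
    ||D_k g||_p <= omega_k(f; h_k) / h_k.  Hence
    cap(K; W) <= (a / delta^a)^(p/q) cap(G; B^alpha)
    ([capW_compact_le_capB]), and delta^(1 - alpha) tends to 1.

    Upper bound.  The estimate has to be uniform over the compact subsets of G,
    and the part t > 1 of the Besov integral requires a bound on the L^p norm
    of the competitor that depends only on its gradient.  Since p < n, averages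
    over cubes provide it: if A_l denotes the average over x + [0, l]^n, then
    ||f - A_l f||_p <= l sum_k ||D_k f||_p and |A_l g| <= l^(-n/p) ||g||_p, so
    that sup |A_l f| <= 2 l^(1 - n/p) sum_k ||D_k f||_p + sup |A_(2l) f|.
    Iterating over dyadic scales and summing the geometric series,
    sup |A_l f| <= C l^(1 - n/p) sum_k ||D_k f||_p, which is small for l large.
    Therefore the positive part of f - eps is dominated by |f - A_l f| and its
    L^p norm is at most l sum_k ||D_k f||_p ([truncation_Lp_bound]).
    Composing f with phi(t) = c (t - eps) exp(- eps / (t - eps)) (and 0 for
    t <= eps), which is smooth, has 0 <= phi' <= c because
    (1 + y) exp(- y) <= 1, and is at least 1 for t >= 1, gives an admissible g
    with ||D_k g||_p <= c ||D_k f||_p and ||g||_p <= M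
    ([truncated_competitor]).  Splitting the Besov integral of g at t = 1 yields
    the upper estimate ([capB_upper_bound]) with a remainder that vanishes as
    alpha tends to 1, and c > 1 is arbitrary. *)

(** * Measurability and translation invariance in R^n *)

Section measurability_rV.
Context {R : realType} {n : nat}.
Local Notation V := 'rV[R]_n.

Lemma measurable_box (A : 'I_n -> set (measurableTypeR R)) :
  (forall i, measurable (A i)) ->
    measurable [set v : V | forall i, A i (v ord0 i)].
Proof.
move=> mA; rewrite (_ : [set v | _] = \bigcap_(i in [set: 'I_n])
    ((fun v : V => v ord0 i) @^-1` A i)); last first.
  by apply/seteqP; split=> v h i; [move=> _|]; exact: h.
apply: fin_bigcap_measurable; first exact: finite_finset.
move=> i _; rewrite -[X in measurable X]setTI.
exact: measurable_coord.
Qed.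

Lemma measurable_rV_cube (x : V) (e : R) :
  measurable [set y : V | forall i, `|x ord0 i - y ord0 i| < e].
Proof.
apply: (@measurable_box (fun i => [set t | `|x ord0 i - t| < e])) => i.
by rewrite (_ : [set t | _] = ball (x ord0 i) e)//; exact: measurable_ball.
Qed.

Lemma rV_cube_ball (x y : V) (e : R) : 0 < e ->
  (forall i, `|x ord0 i - y ord0 i| < e) -> ball x e y.
Proof. by move=> e0 h; split=> // i j; rewrite (ord1 i); exact: h. Qed.

(** An open set is a countable union of rational cubes. *)
Lemma open_measurable_rV (U : set V) : open U -> measurable U.
Proof.
move=> oU.
pose B (k : 'rV[rat]_n * nat) : set V :=
  [set y | forall i, `|ratr (k.1 ord0 i) - y ord0 i| < k.2.+1%:R^-1].
pose F (k : 'rV[rat]_n * nat) : set V :=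
  if `[< B k `<=` U >] then B k else set0.
rewrite (_ : U = \bigcup_k F k); last first.
  apply/seteqP; split=> [x Ux|x [k _]]; last first.
    by rewrite /F; case: asboolP => // h /h.
  have /nbhs_ballP[e /= e0 He] : nbhs x U by apply: open_nbhs_nbhs.
  have [m Hm] : exists m : nat, m.+1%:R^-1 < e / 2.
    have /cvgrPdist_lt/(_ (e / 2)) := @cvg_harmonic R.
    rewrite divr_gt0// => /(_ isT)[m _ /(_ m (leqnn m))] /=.
    rewrite sub0r normrN ger0_norm ?invr_ge0//; by exists m.
  have h i : exists q : rat, `|ratr q - x ord0 i| < m.+1%:R^-1.
    have [|q] := @rat_in_itvoo R (x ord0 i - m.+1%:R^-1) (x ord0 i).
      by rewrite ltrBlDr ltrDl invr_gt0.
    rewrite in_itv/= => /andP[q1 q2]; exists q.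
    by rewrite ltr_norml; apply/andP; split; [by rewrite ltrBrDr addrC|];
      rewrite (@lt_trans _ _ 0)// ?subr_lt0// invr_gt0.
  have [qq Hq] := choice h.
  exists (\row_i qq i, m) => //; rewrite /F asboolT.
    by move=> i /=; rewrite mxE; exact: Hq.
  move=> y By; apply: He; apply: rV_cube_ball => // i.
  have := By i; rewrite /= mxE => By'; have Hq' := Hq i.
  rewrite distrC in Hq'.
  rewrite -(subrK (ratr (qq i)) (x ord0 i)) -addrA
    (le_lt_trans (ler_normD _ _))//.
  by rewrite (splitr e) ltrD// (lt_trans _ Hm).
apply: (@countable_bigcupT_measurable _ _ ('rV[rat]_n * nat)%type) => //.
move=> k; rewrite /F; case: asboolP => // _.
have := measurable_rV_cube (\row_i ratr (k.1 ord0 i)) k.2.+1%:R^-1.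
by under eq_set do under eq_forall do rewrite mxE.
Qed.

Lemma continuous_measurable_rV (f : V -> R) :
  continuous f -> measurable_fun setT f.
Proof.
move=> /continuousP cf; apply: (measurability _ (RGenOpens.measurableE R)).
move=> _ [_ [a [b ->] <-]]; rewrite setTI.
by apply: open_measurable_rV; apply: cf; exact: interval_open.
Qed.

Lemma measurable_fun_addrV d (T : measurableType d) (f g : T -> V) :
  measurable_fun setT f -> measurable_fun setT g ->
  measurable_fun setT (fun t => f t + g t).
Proof.
move=> mf mg; apply: measurable_fun_rV => i.
under eq_fun do rewrite mxE.
apply: measurable_funD.
  exact: (measurableT_comp (measurable_coord i) mf).
exact: (measurableT_comp (measurable_coord i) mg).
Qed.

Lemma measurable_fun_scalerV d (T : measurableType d) (f : T -> R) (v : V) :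
  measurable_fun setT f -> measurable_fun setT (fun t => f t *: v).
Proof.
move=> mf; apply: measurable_fun_rV => i.
by under eq_fun do rewrite mxE; apply: measurable_funM.
Qed.

End measurability_rV.

Section translation.
Context {R : realType}.
Local Open Scope ereal_scope.

Lemma lebesgue_measure_addr (a : R) (A : set (measurableTypeR R)) :
  measurable A ->
  pushforward (@lebesgue_measure R)
    (fun x : measurableTypeR R => (x + a)%R : measurableTypeR R) A
  = lebesgue_measure A.
Proof.
move=> mA; apply/esym.
have mf : measurable_fun [set: measurableTypeR R]
  (fun x : measurableTypeR R => (x + a)%R : measurableTypeR R).
  by apply: measurable_funD.
pose m1 := isMeasurableFun.Build _ _ _ _ _ mf.
pose F : {mfun measurableTypeR R >-> measurableTypeR R} :=
  HB.pack (fun x : measurableTypeR R => (x + a)%R : measurableTypeR R) m1.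
apply: (lebesgue_measure_unique (mu := pushforward (@lebesgue_measure R) F)) =>
  //.
move=> X [[b c] /= _ <-]; rewrite /pushforward /=.
rewrite (_ : _ @^-1` _ = `](b - a)%R, (c - a)%R]%classic); last first.
  by apply/seteqP; split => x /=; rewrite !in_itv/= => /andP[h1 h2];
    apply/andP; split; lra.
rewrite !lebesgue_measure_itv/= !lte_fin ltrD2r.
by case: ifPn => // _; rewrite -!EFinB; congr EFin; lra.
Qed.

Lemma ge0_integral_addr1 (a : R) (f : measurableTypeR R -> \bar R) :
  measurable_fun setT f -> (forall x, 0 <= f x) ->
  \int[@lebesgue_measure R]_x f (x + a)%R = \int[@lebesgue_measure R]_x f x.
Proof.
move=> mf f0.
have mg : measurable_fun [set: measurableTypeR R]
  (fun x : measurableTypeR R => (x + a)%R : measurableTypeR R).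
  by apply: measurable_funD.
have := ge0_integral_pushforward mg (@lebesgue_measure R) measurableT mf
  (fun y _ => f0 y).
rewrite preimage_setT => /esym E; rewrite [LHS]E.
by apply: eq_measure_integral => A mA _; exact: lebesgue_measure_addr.
Qed.

Lemma integral_rVS n (f : 'rV[R]_n.+1 -> \bar R) :
  measurable_fun setT f -> (forall x, 0 <= f x) ->
  \int[lebesgue_rV R n.+1]_x f x =
  \int[@lebesgue_measure R]_x \int[lebesgue_rV R n]_y f (rV_cons (x, y)).
Proof.
move=> mf f0.
transitivity (\int[(@lebesgue_measure R) \x (lebesgue_rV R n)]_xy f
  (rV_cons xy)).
  by rewrite (ge0_integral_pushforward (@measurable_rV_cons R n) _ measurableT
    mf).
apply: (fubini_tonelli1 (fun xy => f (rV_cons xy))) => //.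
by apply: (measurableT_comp mf); exact: measurable_rV_cons.
Qed.

Lemma rV_consD n (x x' : R) (y y' : 'rV[R]_n) :
  (rV_cons (x, y) + rV_cons (x', y') = rV_cons (x + x', y + y'))%R.
Proof.
apply/rowP => i; case: (unliftP ord0 i) => [j|] ->; rewrite mxE.
  by rewrite !rV_consS mxE.
by rewrite !rV_cons0.
Qed.

Lemma rV_unconsK n (v : 'rV[R]_n.+1) : rV_cons (rV_uncons v) = v.
Proof.
apply/rowP => i; case: (unliftP ord0 i) => [j|] ->.
  by rewrite rV_consS /= mxE.
by rewrite rV_cons0.
Qed.

(** Translation invariance of [lebesgue_rV], by induction on the dimension. *)
Lemma ge0_integral_addrV n (a : 'rV[R]_n) (f : 'rV[R]_n -> \bar R) :
  measurable_fun setT f -> (forall x, 0 <= f x) ->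
  \int[lebesgue_rV R n]_x f (x + a)%R = \int[lebesgue_rV R n]_x f x.
Proof.
elim: n a f => [|n IH] a f mf f0.
  by congr integral; apply/funext => x; congr f; apply/rowP => -[].
have mfa : measurable_fun setT (fun x : 'rV[R]_n.+1 => f (x + a)%R).
  apply: (measurableT_comp mf); apply: measurable_fun_addrV => //.
rewrite !integral_rVS// -{1}(rV_unconsK a).
case: (rV_uncons a) => [a1 a2].
transitivity (\int[lebesgue_measure]_x \int[lebesgue_rV R n]_y f
  (rV_cons (x + a1, y)%R)).
  apply: eq_integral => x _; under eq_integral do rewrite rV_consD.
  apply: (IH a2 (fun y => f (rV_cons (x + a1, y)%R))) => //.
  apply: (measurableT_comp mf);
    apply: (measurableT_comp (@measurable_rV_cons R n)).
  exact: measurable_pair1.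
apply: (@ge0_integral_addr1 a1
  (fun x => \int[lebesgue_rV R n]_y f (rV_cons (x, y)))).
  apply: (measurable_fun_fubini_tonelli_F (fun xy => f (rV_cons xy))) => //.
  by apply: (measurableT_comp mf); exact: measurable_rV_cons.
by move=> x; apply: integral_ge0.
Qed.

End translation.

(** * Jensen's inequality and averages in L^p *)

Section lebesgue_integral_extra.
Local Open Scope ereal_scope.
Context d (T : measurableType d) (R : realType).
Variable mu : {measure set T -> \bar R}.

Import HBNNSimple.
(** Monotonicity of the integral of nonnegative functions that need not be
    measurable: the integral is a supremum over simple functions. *)
Lemma ge0_le_integral_pointwise (D : set T) (f g : T -> \bar R) :
  (forall x, D x -> 0 <= f x) -> (forall x, D x -> f x <= g x) ->
  \int[mu]_(x in D) f x <= \int[mu]_(x in D) g x.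
Proof.
move=> f0 fg; rewrite (integral_mkcond D f) (integral_mkcond D g).
have f0' x : 0 <= (f \_ D) x by rewrite patchE; case: ifPn => // /set_mem /f0.
have fg' x : (f \_ D) x <= (g \_ D) x.
  by rewrite !patchE; case: ifPn => // /set_mem /fg.
have g0' x : 0 <= (g \_ D) x by exact: le_trans (f0' x) (fg' x).
rewrite !ge0_integralTE//.
apply: le_ereal_sup => _ [h hf <-]; exists h => // x.
exact: le_trans (hf x) (fg' x).
Qed.

End lebesgue_integral_extra.

Section jensen.
Context (R : realType).

(** Tangent line inequality for the convex function [powR ^~ p] at [a]. *)
Lemma young_powR (p a b : R) : 1 <= p -> 0 <= a -> 0 <= b ->
  p * a `^ (p - 1) * b <= b `^ p + (p - 1) * a `^ p.
Proof.
move=> p1 a0 b0; have p0 : 0 < p by exact: lt_le_trans p1.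
have [->|pn1] := eqVneq p 1.
  by rewrite subrr powRr0 mul0r addr0 !mul1r powRr1.
have p10 : 0 < p - 1 by rewrite subr_gt0 lt_neqAle eq_sym pn1.
have pN0 : p != 0 by rewrite gt_eqF.
have pB0 : p - 1 != 0 by rewrite gt_eqF.
have := @conjugate_powR R b (a `^ (p - 1)) p (p / (p - 1)) b0 (powR_ge0 _ _) p0.
rewrite divr_gt0// => /(_ isT); rewrite -powRrM.
have -> : (p - 1) * (p / (p - 1)) = p by field.
have -> : p^-1 + (p / (p - 1))^-1 = 1 by field; rewrite pN0 pB0.
move=> /(_ erefl); rewrite -(ler_pM2l p0) => h.
apply: le_trans (le_trans h _); first by rewrite -mulrA (mulrC b).
rewrite le_eqVlt; apply/orP; left; apply/eqP; by field; rewrite pN0 pB0.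
Qed.

Context d (T : measurableType d) (mu : {measure set T -> \bar R}).

Lemma measurable_powR_norm (p : R) (D : set T) (f : T -> R) : measurable_fun D
  f ->
  measurable_fun D (fun x => (`|f x| `^ p)%:E).
Proof.
move=> mf; apply/measurable_EFinP.
by apply: (@measurableT_comp _ _ _ _ _ _ (@powR R ^~ p)) => //;
  exact: measurableT_comp.
Qed.

(** Jensen's inequality for the average over a set [D] of measure [m], obtained
    by integrating [young_powR] with [a] equal to the average of [|f|]. *)
Lemma jensen_powR (p m : R) (D : set T) (f : T -> R) : 1 <= p -> 0 < m ->
  measurable D -> mu D = m%:E -> mu.-integrable D (EFin \o f) ->
  ((`|m^-1 * \int[mu]_(x in D) f x| `^ p)%:E <=
   m^-1%:E * \int[mu]_(x in D) (`|f x| `^ p)%:E)%E.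
Proof.
move=> p1 m0 mD muD intf.
have mf : measurable_fun D f by apply/measurable_EFinP;
  exact: measurable_int intf.
have intnf : mu.-integrable D (EFin \o (fun x => `|f x|))
  by exact: integrable_norm.
have I0 : 0 <= \int[mu]_(x in D) `|f x| by exact: Rintegral_ge0.
set I := \int[mu]_(x in D) `|f x| in I0.
have IE : (\int[mu]_(x in D) `|f x|%:E)%E = I%:E.
  by rewrite /I /Rintegral fineK//; exact: integrable_fin_num intnf.
pose a := m^-1 * I.
have a0 : 0 <= a by rewrite mulr_ge0// invr_ge0 ltW.
have p0 : 0 <= p by exact: le_trans p1.
apply: (@le_trans _ _ (a `^ p)%:E).
  rewrite lee_fin ge0_ler_powR ?nnegrE//.
  rewrite normrM gtr0_norm ?invr_gt0// ler_pM2l ?invr_gt0//.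
  exact: le_normr_Rintegral.
rewrite -lee_pdivrMl ?invr_gt0// invrK.
have : (\int[mu]_(x in D) ((p * a `^ (p - 1))%:E * `|f x|%:E) <=
        \int[mu]_(x in D) ((`|f x| `^ p)%:E + ((p - 1) * a `^ p)%:E))%E.
  apply: ge0_le_integral_pointwise => x _; rewrite -?EFinM -?EFinD lee_fin.
    by rewrite !mulr_ge0// powR_ge0.
  exact: young_powR.
rewrite ge0_integralZl//; last 2 first.
- by apply/measurable_EFinP; exact: measurableT_comp.
- by rewrite lee_fin mulr_ge0// powR_ge0.
rewrite ge0_integralD//; last 2 first.
- exact: measurable_powR_norm.
- by move=> x _; rewrite lee_fin mulr_ge0 ?powR_ge0// subr_ge0.
rewrite integral_cst// IE [X in (_ <= _ + _ * X)%E -> _]muD -!EFinM.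
set J := (\int[mu]_(x in D) _)%E.
have IamE : I = a * m by rewrite /a mulrC mulrA divff ?mul1r// gt_eqF.
have -> : p * a `^ (p - 1) * I = p * a `^ p * m.
  rewrite IamE -mulrA [X in p * X]mulrA [a `^ _ * _]mulrC mulr_powRB1 ?mulrA//.
  exact: lt_le_trans p1.
have : (0 <= J)%E by apply: integral_ge0 => x _; rewrite lee_fin powR_ge0.
case: J => [j| |]// j0; last by move=> _; exact: leey.
by rewrite -EFinD !lee_fin => h; nra.
Qed.

End jensen.

Section Lp_norm.
Context {R : realType} {n : nat}.
Local Notation V := 'rV[R]_n.
Local Notation mu := (lebesgue_rV R n).
Variable p : R.
Hypothesis p1 : 1 <= p.
Implicit Types u v : V -> R.

Let p0 : 0 < p. Proof. exact: lt_le_trans p1. Qed.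
Let pn0 : p != 0. Proof. by rewrite gt_eqF. Qed.

Lemma norm_Lp_ge0 u : (0 <= norm_Lp p u)%E.
Proof. exact: Lnorm_ge0. Qed.

Lemma norm_LpE u : norm_Lp p u = ((\int[mu]_x (`|u x| `^ p)%:E) `^ p^-1)%E.
Proof. by rewrite /norm_Lp unlock. Qed.

Lemma norm_Lp_powR u : (norm_Lp p u `^ p = \int[mu]_x (`|u x| `^ p)%:E)%E.
Proof. by rewrite /norm_Lp poweR_Lnorm. Qed.

Lemma norm_Lp_leP u (C : R) : 0 <= C ->
  (norm_Lp p u <= C%:E)%E <-> (\int[mu]_x (`|u x| `^ p)%:E <= (C `^ p)%:E)%E.
Proof.
move=> C0.
have I0 : (0 <= \int[mu]_x (`|u x| `^ p)%:E)%E.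
  by apply: integral_ge0 => x _; rewrite lee_fin powR_ge0.
split=> h.
  rewrite -norm_Lp_powR -poweR_EFin gt0_ler_poweR ?(ltW p0)// ?in_itv/=.
  - by rewrite norm_Lp_ge0 leey.
  - by rewrite lee_fin C0 leey.
rewrite norm_LpE -[C]powRr1// -(mulfV pn0) powRrM -poweR_EFin.
apply: gt0_ler_poweR => //.
- by rewrite invr_ge0 ltW.
- by rewrite in_itv/= I0 leey.
- by rewrite in_itv/= lee_fin powR_ge0 leey.
Qed.

Lemma norm_Lp_le u v : (forall x, `|u x| <= `|v x|) ->
  (norm_Lp p u <= norm_Lp p v)%E.
Proof.
move=> uv; rewrite !norm_LpE; apply: gt0_ler_poweR => //.
- by rewrite invr_ge0 ltW.
- by rewrite in_itv/= leey andbT integral_ge0// => x _;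
    rewrite lee_fin powR_ge0.
- by rewrite in_itv/= leey andbT integral_ge0// => x _;
    rewrite lee_fin powR_ge0.
apply: ge0_le_integral_pointwise => x _; rewrite lee_fin ?powR_ge0//.
by rewrite ge0_ler_powR ?nnegrE// ltW.
Qed.

Lemma norm_LpZ (c : R) u : measurable_fun setT u ->
  norm_Lp p (fun x => c * u x)%R = (`|c|%:E * norm_Lp p u)%E.
Proof.
move=> mu_; rewrite !norm_LpE.
under eq_integral do rewrite normrM powRM// EFinM.
rewrite ge0_integralZl//; last exact: measurable_powR_norm.
rewrite poweRM ?lee_fin ?powR_ge0//; last first.
  by apply: integral_ge0 => x _; rewrite lee_fin powR_ge0.
by rewrite poweR_EFin -powRrM mulfV// powRr1.
Qed.

Lemma norm_LpD u v : measurable_fun setT u -> measurable_fun setT v ->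
  (norm_Lp p (fun x => u x + v x)%R <= norm_Lp p u + norm_Lp p v)%E.
Proof. by move=> mu_ mv; exact: minkowski_EFin. Qed.

Lemma norm_Lp_shift (a : V) u : measurable_fun setT u ->
  norm_Lp p (fun x => u (x + a)%R) = norm_Lp p u.
Proof.
move=> mu_; rewrite !norm_LpE; congr (_ `^ _)%E.
apply: (@ge0_integral_addrV R n a (fun x => (`|u x| `^ p)%:E)).
  exact: measurable_powR_norm.
by move=> x; rewrite lee_fin powR_ge0.
Qed.

Section averages.
Context d (T : measurableType d) (nu : {sigma_finite_measure set T -> \bar R}).
Variables (m : R) (D : set T).
Hypotheses (m0 : 0 < m) (mD : measurable D) (nuD : nu D = m%:E).

(** Minkowski's inequality in integral form: an average of functions whose L^p
    norms are at most [C] has L^p norm at most [C]. *)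
Lemma norm_Lp_average_le (F : V -> T -> R) (C : R) :
  measurable_fun setT (fun xt : V * T => F xt.1 xt.2) ->
  (forall x, nu.-integrable D (EFin \o F x)) -> 0 <= C ->
  (forall t, D t -> (norm_Lp p (F ^~ t) <= C%:E)%E) ->
  (norm_Lp p (fun x => (m^-1 * \int[nu]_(t in D) F x t)%R) <= C%:E)%E.
Proof.
move=> mF iF C0 FC; apply/norm_Lp_leP => //.
pose G (xt : V * T) : \bar R := ((`|F xt.1 xt.2| `^ p)%:E * (\1_D xt.2)%:E)%E.
have G0 z : (0 <= G z)%E by rewrite mule_ge0// lee_fin ?powR_ge0.
have mG : measurable_fun setT G.
  apply: emeasurable_funM; first
    exact: (@measurable_powR_norm R _ _ p setT _ mF).
  apply/measurable_EFinP/measurableT_comp => //.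
have inG x : (\int[nu]_(t in D) (`|F x t| `^ p)%:E = \int[nu]_t G (x, t))%E.
  rewrite integral_mkcond; apply: eq_integral => t _ /=.
  by rewrite patchE /G/= indicE; case: (t \in D); rewrite ?mule1 ?mule0.
apply: (@le_trans _ _ (\int[mu]_x (m^-1%:E * \int[nu]_t G (x, t)))%E).
  apply: ge0_le_integral_pointwise => x _; first by rewrite lee_fin powR_ge0.
  by rewrite -inG; exact: jensen_powR.
rewrite ge0_integralZl//; last 3 first.
- exact: measurable_fun_fubini_tonelli_F.
- by move=> x _; exact: integral_ge0.
- by rewrite lee_fin invr_ge0 ltW.
rewrite (fubini_tonelli G)//.
rewrite -lee_pdivlMl ?invr_gt0// invrK.
apply: (@le_trans _ _ (\int[nu]_t ((C `^ p)%:E * (\1_D t)%:E))%E).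
  apply: ge0_le_integral_pointwise => t _; first exact: integral_ge0.
  rewrite /G/= indicE; case: (boolP (t \in D)) => [/set_mem Dt|_].
    under eq_integral do rewrite mule1.
    by rewrite mule1; apply/(norm_Lp_leP _ C0)/FC.
  by rewrite mule0; under eq_integral do rewrite mule0; rewrite integral0.
rewrite ge0_integralZl//; last 2 first.
- by apply/measurable_EFinP; exact: measurable_indic.
- by rewrite lee_fin powR_ge0.
by rewrite integral_indic// setIT [X in (_ * X <= _)%E]nuD muleC.
Qed.

Lemma measurable_average (F : V -> T -> R) :
  measurable_fun setT (fun xt : V * T => F xt.1 xt.2) ->
  measurable_fun setT (fun x => \int[nu]_(t in D) F x t).
Proof.
move=> mF; rewrite /Rintegral; apply: measurableT_comp => //.
under eq_fun do rewrite integral_mkcond integralE.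
have mG : measurable_fun setT (fun xt : V * T => ((EFin \o F xt.1) \_ D) xt.2).
  rewrite (_ : (fun _ => _)
    = (fun xt : V * T => (F xt.1 xt.2)%:E * (\1_D xt.2)%:E)%E); last first.
    apply/funext => -[x t] /=; rewrite patchE indicE.
    by case: (t \in D); rewrite ?mule1 ?mule0.
  apply: emeasurable_funM; first exact/measurable_EFinP.
  exact/measurable_EFinP/measurableT_comp.
apply: emeasurable_funB.
  have h0 : forall z : V * T,
    (0 <= ((fun xt : V * T => ((EFin \o F xt.1) \_ D) xt.2)^\+ z))%E.
    by move=> z; exact: funepos_ge0.
  apply: eq_measurable_fun (measurable_fun_fubini_tonelli_F (m2 := nu) _
    (measurable_funepos mG) h0).
  by move=> x _; apply: eq_integral => y _; rewrite !funeposE.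
have h0 : forall z : V * T,
  (0 <= ((fun xt : V * T => ((EFin \o F xt.1) \_ D) xt.2)^\- z))%E.
  by move=> z; exact: funeneg_ge0.
apply: eq_measurable_fun (measurable_fun_fubini_tonelli_F (m2 := nu) _
  (measurable_funeneg mG) h0).
by move=> x _; apply: eq_integral => y _; rewrite !funenegE.
Qed.

End averages.

End Lp_norm.

(** * Derivatives along lines and closure properties of smooth functions *)

Section line_derivatives.
Context {R : realType} {n : nat}.
Local Notation V := 'rV[R]_n.
Implicit Types (f : V -> R) (x e : V).

(** The difference quotients of [f] in the direction [e] are those of its
    restriction to the line through [x] directed by [e]. *)
Lemma line_quotE f x e (t : R) :
  (fun h : R => h^-1 *: (((fun t => f (x + t *: e)) \o shift t) (h *: (1 : R)) -
    f (x + t *: e))) =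
  (fun h : R => h^-1 *: ((f \o shift (x + t *: e)) (h *: e) - f (x + t *: e))).
Proof.
apply/funext => h /=; congr (_ *: (f _ - _)).
by rewrite [h%:A]mulr1 scalerDl addrCA.
Qed.

Lemma is_derive_line f x e (t : R) : derivable f (x + t *: e) e ->
  is_derive t 1 (fun t => f (x + t *: e)) ('D_e f (x + t *: e)).
Proof.
move=> df; apply: DeriveDef.
  by rewrite /derivable line_quotE.
by rewrite /derive line_quotE.
Qed.

Lemma is_derive_line0 f x e (df : R) :
  is_derive (0 : R) 1 (fun t => f (x + t *: e)) df -> is_derive x e f df.
Proof.
have E : (fun h : R => h^-1 *:
  (((fun t => f (x + t *: e)) \o shift 0) (h *: (1 : R)) -
    f (x + 0 *: e))) = (fun h : R => h^-1 *: ((f \o shift x) (h *: e) - f x)).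
  by rewrite line_quotE scale0r addr0.
case; rewrite /derivable /derive E => h1 h2; exact: DeriveDef.
Qed.

Lemma is_derive_line_scale f x e (h t : R) :
  derivable f (x + t *: (h *: e)) e ->
  is_derive t 1 (fun t => f (x + t *: (h *: e)))
    (h * 'D_e f (x + t *: (h *: e))).
Proof.
move=> df; rewrite mulrC.
have -> : (fun t => f (x + t *: (h *: e))) = (fun t => f (x + t *: e)) \o
  (fun t => t * h).
  by apply/funext => s /=; rewrite scalerA.
apply: is_derive1_comp.
  by rewrite scalerA; apply: is_derive_line; rewrite -scalerA.
rewrite -[X in is_derive _ _ _ X]mul1r.
have := @is_deriveM R R id (cst h) t 1 1 0 _ _.
move=> [h1 h2]; apply: DeriveDef => //.
by rewrite h2 /= scaler0 add0r /GRing.scale/= mulr1 mul1r.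
Qed.

Lemma continuous_line x e : continuous (fun t : R => x + t *: e).
Proof.
move=> t; apply: cvgD; first exact: cvg_cst.
exact: (@scalel_continuous _ V e t).
Qed.

Lemma continuous_addV (a : V) : continuous (fun x : V => x + a).
Proof. by move=> x; apply: (@continuousD _ V V id (cst a) x);
  [exact: cvg_id | exact: cst_continuous]. Qed.

(** The increment of [f] along [h *: e] as an integral of its directional
    derivative. *)
Lemma FTC_line f x e (h : R) :
  (forall y, derivable f y e) -> continuous ('D_e f) ->
  \int[@lebesgue_measure R]_(s in `[0, 1]) (h * 'D_e f (x + s *: (h *: e))) =
  f (x + h *: e) - f x.
Proof.
move=> df cf.
have dF t := is_derive_line_scale (df (x + t *: (h *: e))).
pose g s := h * 'D_e f (x + s *: (h *: e)).
have cg : continuous g.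
  move=> t; apply: cvgM; first exact: cvg_cst.
  by apply: (@continuous_comp _ _ _ (fun s : R => x + s *: (h *: e)) ('D_e f)
    t);
    [exact: continuous_line | exact: cf].
have cF : continuous (fun t : R => f (x + t *: (h *: e))).
  by move=> t; apply/differentiable_continuous/derivable1_diffP; case: (dF t).
rewrite /Rintegral (@continuous_FTC2 _ g (fun t => f (x + t *: (h *: e)))).
- by rewrite -EFinB/= scale1r scale0r addr0.
- exact: ltr01.
- exact: continuous_subspaceT.
- split.
  + by move=> t _; case: (dF t).
  + by apply: cvg_at_right_filter; exact: cF.
  + by apply: cvg_at_left_filter; exact: cF.
- by move=> t _; rewrite derive1E; case: (dF t).
Qed.

End line_derivatives.

Section smooth_closure.
Context {R : realType} {n : nat}.
Local Notation V := 'rV[R]_n.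
Implicit Types (f g : V -> R).

(** The class C^m, described by iterated partial derivatives.  Unlike [smooth],
    which quantifies over lists of indices, it peels off the innermost
    derivative first, so that product and chain rules go by induction on [m]. *)
Fixpoint Ck (m : nat) f : Prop :=
  continuous f /\
  if m is m'.+1 then
    forall k, (forall x, derivable f x (unit_vec k)) /\ Ck m' (partial k f)
  else True.

Lemma iter_partial_rcons s k f :
  iter_partial (rcons s k) f = iter_partial s (partial k f).
Proof. by rewrite /iter_partial foldr_rcons. Qed.

Lemma smooth_continuous f : smooth f -> continuous f.
Proof. by move=> /(_ [::])[]. Qed.

Lemma smooth_derivable f : smooth f -> forall k x, derivable f x (unit_vec k).
Proof. by move=> /(_ [::])[]. Qed.

Lemma smooth_partial f k : smooth f -> smooth (partial k f).
Proof. by move=> sf s; rewrite -iter_partial_rcons; exact: sf. Qed.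

Lemma smoothP f : smooth f <-> forall m, Ck m f.
Proof.
split=> [sf m|].
  elim: m f sf => [|m IH] f sf; split => //; try exact: smooth_continuous.
  by move=> k; split; [exact: smooth_derivable | exact/IH/smooth_partial].
move=> Cf s; elim/last_ind: s f Cf => [|s k IH] f Cf.
  by split; [case: (Cf 0) | move=> k x; case: (Cf 1) => _ /(_ k)[]].
rewrite iter_partial_rcons; apply: IH => m.
by case: (Cf m.+1) => _ /(_ k)[].
Qed.

Lemma Ck_S m f : Ck m.+1 f -> Ck m f.
Proof.
elim: m f => [|m IH] f [cf Df]; split => // k; have [d1 d2] := Df k.
by split => //; exact: IH.
Qed.

Lemma Ck_add m f g : Ck m f -> Ck m g -> Ck m (fun x => f x + g x).
Proof.
elim: m f g => [|m IH] f g [cf Df] [cg Dg].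
  by split => // x; apply: (@continuousD R R V f g x); [exact: cf | exact: cg].
split=> [x|k]; first by apply: (@continuousD R R V f g x);
  [exact: cf | exact: cg].
have [f1 f2] := Df k; have [g1 g2] := Dg k; split.
  by move=> x; exact: derivableD.
rewrite (_ : partial k _ = (fun x => partial k f x + partial k g x)).
  exact: IH.
by apply/funext => x; rewrite /partial deriveD.
Qed.

Lemma Ck_mul m f g : Ck m f -> Ck m g -> Ck m (fun x => f x * g x).
Proof.
elim: m f g => [|m IH] f g Cf Cg; have [cf Df] := Cf; have [cg Dg] := Cg.
  by split => // x; apply: (@continuousM R V f g x); [exact: cf | exact: cg].
split=> [x|k]; first by apply: (@continuousM R V f g x);
  [exact: cf | exact: cg].
have [f1 f2] := Df k; have [g1 g2] := Dg k; split.
  by move=> x; exact: derivableM.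
rewrite (_ : partial k _ = (fun x =>
  f x * partial k g x + g x * partial k f x)).
  by apply: Ck_add; apply: IH => //; exact: Ck_S.
by apply/funext => x; rewrite /partial deriveM.
Qed.

Lemma is_derive_comp_scalar (phi dphi : R -> R) f x (e : V) :
  (forall t : R, is_derive t 1 phi (dphi t)) -> derivable f x e ->
  is_derive x e (phi \o f) (dphi (f x) * 'D_e f x).
Proof.
move=> dp df; apply: is_derive_line0.
have -> : (fun t : R => (phi \o f) (x + t *: e)) = phi \o
  (fun t => f (x + t *: e)) by [].
have df0 : derivable f (x + 0 *: e) e by rewrite scale0r addr0.
apply: is_derive1_comp.
  by rewrite scale0r addr0; exact: dp.
by have := is_derive_line df0; rewrite scale0r addr0.
Qed.

(** Composition with a function of one variable given together with all its
    derivatives, [Phi j.+1] being the derivative of [Phi j]. *)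
Lemma smooth_comp (Phi : nat -> R -> R) f :
  (forall j (t : R), is_derive t 1 (Phi j) (Phi j.+1 t)) -> smooth f ->
  smooth (Phi 0%N \o f).
Proof.
move=> dPhi sf; suff H m j : Ck m (Phi j \o f) by apply/smoothP => m; exact: H.
have cPhi i : continuous (Phi i).
  move=> t; apply/differentiable_continuous/derivable1_diffP.
  by case: (dPhi i t).
have cPf i : continuous (Phi i \o f).
  by move=> x; apply: continuous_comp; [exact: smooth_continuous | exact: cPhi].
elim: m j => [|m IH] j; split => // k.
have D x : is_derive x (unit_vec k) (Phi j \o f)
  (Phi j.+1 (f x) * partial k f x).
  by apply: is_derive_comp_scalar => //; exact: smooth_derivable.
split; first by move=> x; case: (D x).
rewrite (_ : partial k _ = (fun x => (Phi j.+1 \o f) x * partial k f x)).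
  apply: Ck_mul => //.
  by have /smoothP := smooth_partial k sf.
by apply/funext => x; rewrite /partial /=; case: (D x).
Qed.

(** A class of continuous functions that is stable under partial derivatives
    consists of smooth functions, provided that these derivatives exist. *)
Lemma smooth_coind (P : (V -> R) -> Prop) :
  (forall f, P f -> continuous f) ->
  (forall f, P f -> forall k,
    (forall x, derivable f x (unit_vec k)) /\ P (partial k f)) ->
  forall f, P f -> smooth f.
Proof.
move=> P1 P2 f Pf; apply/smoothP => m.
elim: m f Pf => [|m IH] f Pf; split; try exact: P1; move=> //.
by move=> k; have [? ?] := P2 _ Pf k; split => //; exact: IH.
Qed.

End smooth_closure.

(** * Test functions and Steklov averages *)

Lemma bounded_by_integrable d (T : measurableType d) (R : realType)
    (mu : {measure set T -> \bar R}) (A : set T) (f : T -> R) (M : R) :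
  measurable A -> (mu A < +oo)%E -> measurable_fun A f ->
  (forall x, A x -> `|f x| <= M) -> mu.-integrable A (EFin \o f).
Proof.
move=> mA muA mf fM; apply: measurable_bounded_integrable => //.
exists M; split; first exact: num_real.
by move=> y My x Ax; apply: le_trans (fM _ Ax) (ltW My).
Qed.

Section test_functions.
Context {R : realType} {n : nat}.
Local Notation V := 'rV[R]_n.
Local Notation mu := (lebesgue_rV R n).
Implicit Types (f u : V -> R) (K : set V).

(** Elements of C_0^oo. *)
Definition test_fun u := smooth u /\ compactly_supported u.

Lemma coord_le_norm (v : V) i : `|v ord0 i| <= `|v|.
Proof.
rewrite [leRHS]/Num.Def.normr /= mx_normrE; apply/bigmax_geP; right => /=.
by exists (ord0, i).
Qed.

Lemma norm_le_coord (v : V) (r : R) : 0 <= r ->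
  (forall i, `|v ord0 i| <= r) -> `|v| <= r.
Proof.
move=> r0 h; rewrite [leLHS]/Num.Def.normr /= mx_normrE; apply/bigmax_leP;
  split => //.
by move=> -[i j] _ /=; rewrite (ord1 i).
Qed.

Lemma compactly_supportedP u K : compact K ->
  (forall x, ~ K x -> u x = 0) -> compactly_supported u.
Proof.
move=> cK uK; apply: (@subclosed_compact _ _ K) => //.
  exact: closed_closure.
have /closure_id -> : closed K by apply: compact_closed => //;
  exact: norm_hausdorff.
apply: closure_subset => x /= ux; apply: contrapT => /uK ux0.
by rewrite ux0 eqxx in ux.
Qed.

Lemma near_notin_support u x : ~ closure [set x | u x != 0] x ->
  \forall y \near x, u y = 0.
Proof.
move=> nx.
have : nbhs x (~` closure [set x | u x != 0]).
  by apply: open_nbhs_nbhs; split => //; apply: closed_openC;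
    exact: closed_closure.
apply: filterS => y ny; apply/eqP/negPn/negP => uy.
by apply: ny; apply: subset_closure.
Qed.

Lemma compactly_supported_partial k u :
  compactly_supported u -> compactly_supported (partial k u).
Proof.
move=> cu; apply: (compactly_supportedP cu) => x /near_notin_support ux0.
rewrite /partial (@near_eq_derive _ _ _ u (cst 0)) ?derive_cst//.
Qed.

Lemma test_fun_partial k u : test_fun u -> test_fun (partial k u).
Proof.
by move=> [su cu]; split;
  [exact: smooth_partial|exact: compactly_supported_partial].
Qed.

Lemma compactly_supported_bounded u : continuous u -> compactly_supported u ->
  exists M, forall x, `|u x| <= M.
Proof.
move=> cu su.
have /compact_bounded[M [_ HM]] : compact (u @` closure [set x | u x != 0]).
  by apply: continuous_compact => //; exact: continuous_subspaceT.
exists (Num.max 0 (M + 1)) => x.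
have [->|ux] := eqVneq (u x) 0; first by rewrite normr0 le_max lexx.
rewrite le_max; apply/orP; right; apply: (HM (M + 1)); first by rewrite ltrDl.
by exists x => //; apply: subset_closure.
Qed.

Lemma test_fun_continuous u : test_fun u -> continuous u.
Proof. by move=> [/smooth_continuous]. Qed.

Lemma test_fun_measurable u : test_fun u -> measurable_fun setT u.
Proof. by move=> /test_fun_continuous/continuous_measurable_rV. Qed.

Lemma test_fun_bounded u : test_fun u -> exists M, forall x, `|u x| <= M.
Proof. by move=> [/smooth_continuous cu su];
  exact: compactly_supported_bounded. Qed.

Lemma test_fun_derivable u k x : test_fun u -> derivable u x (unit_vec k).
Proof. by move=> [su _]; exact: smooth_derivable. Qed.

Lemma prode_fin_num (I : finType) (F : I -> \bar R) :
  (forall i, F i \is a fin_num) -> (\prod_i F i)%E \is a fin_num.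
Proof. by move=> h; elim/big_ind : _ => // x y; exact: fin_numM. Qed.

Lemma norm_Lp_test_fin p u : 1 <= p -> test_fun u -> (norm_Lp p u < +oo)%E.
Proof.
move=> p1 tu; have [M uM] := test_fun_bounded tu.
have p0 : 0 < p by exact: lt_le_trans p1.
have [su] := tu; move/compact_bounded => [B [_ HB]].
pose A (i : 'I_n) : set (measurableTypeR R) := `[- (B + 1), B + 1]%classic.
pose Q := [set v : V | forall i, A i (v ord0 i)].
have mA i : measurable (A i) by exact: measurable_itv.
have muQ : (mu Q < +oo)%E.
  rewrite /Q lebesgue_rV_box// -ge0_fin_numE; last first.
    by apply: prode_ge0 => i _; exact: measure_ge0.
  apply: prode_fin_num => i; rewrite /A lebesgue_measure_itv/=.
  by case: ifP.
have mQ : measurable Q by exact: measurable_box.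
rewrite norm_LpE; apply: poweR_lty.
apply: (@le_lt_trans _ _ (\int[mu]_x ((M `^ p)%:E * (\1_Q x)%:E))%E).
  apply: ge0_le_integral_pointwise => x _; first by rewrite lee_fin powR_ge0.
  rewrite -EFinM lee_fin.
  have [->|ux] := eqVneq (u x) 0.
    by rewrite normr0 powR0 ?gt_eqF// mulr_ge0// powR_ge0.
  rewrite indicE mem_set ?mulr1.
    by rewrite ge0_ler_powR ?nnegrE ?(ltW p0)// (le_trans _ (uM x)).
  move=> i; rewrite /A /= in_itv/= -ler_norml.
  apply: le_trans (coord_le_norm _ _) _.
  by apply: (HB (B + 1)); [rewrite ltrDl|apply: subset_closure].
rewrite ge0_integralZl//; last 2 first.
- by apply/measurable_EFinP; exact: measurable_indic.
- by rewrite lee_fin powR_ge0.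
rewrite integral_indic// setIT lte_mul_pinfty ?lee_fin ?powR_ge0//.
Qed.

End test_functions.

Section steklov.
Context {R : realType} {n : nat}.
Local Notation V := 'rV[R]_n.
Local Notation mu := (lebesgue_rV R n).
Local Notation leb := (@lebesgue_measure R).
Implicit Types (f u : V -> R) (K : set V) (e v : V).

(** The average of [u] over the segment joining [x] to [x + v]. *)
Definition steklov v u : V -> R :=
  fun x => \int[leb]_(s in `[0, 1]) u (x + s *: v).

Lemma continuous_line_comp u x v : continuous u ->
  continuous (fun s : R => u (x + s *: v)).
Proof.
move=> cu s; apply: (@continuous_comp _ _ _ (fun s : R => x + s *: v) u s).
  exact: continuous_line.
exact: cu.
Qed.

Lemma integrable_line u x v (a b : R) : continuous u ->
  leb.-integrable `[a, b] (EFin \o (fun s => u (x + s *: v))).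
Proof.
move=> cu; apply: continuous_compact_integrable; first exact: segment_compact.
by apply: continuous_subspaceT; exact: continuous_line_comp.
Qed.

Lemma leb01 : leb `[0, 1]%classic = 1%:E.
Proof. by rewrite lebesgue_measure_itv/= lte01 oppr0 adde0. Qed.

Lemma Rintegral01_cst (c : R) : \int[leb]_(s in `[0, 1]) c = c.
Proof.
rewrite Rintegral_cst//; transitivity (c * fine 1%:E); last by rewrite mulr1.
by congr (_ * fine _); exact: leb01.
Qed.

Lemma leb01_lty : (leb `[0%R, 1%R]%classic < +oo)%E.
Proof. by rewrite leb01 ltry. Qed.

Lemma continuous_add_scale v : continuous (fun z : R * V => z.2 + z.1 *: v).
Proof.
move=> z; apply: (@continuousD _ V (R * V)%type snd (fun z => z.1 *: v) z).
  exact: cvg_snd.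
apply: (@continuous_comp _ _ _ fst (fun s : R => s *: v) z).
  exact: cvg_fst.
exact: (@scalel_continuous _ V v z.1).
Qed.

(** The increments of [u] are small uniformly along the compact segment. *)
Lemma steklov_continuous v u : continuous u -> continuous (steklov v u).
Proof.
move=> cu x; apply/(@cvgrPdist_le R R V (nbhs x) (nbhs_filter x) (steklov v u))
  => e e0.
have C : compact (`[0, 1]%classic : set R) by exact: segment_compact.
have : \forall y \near x, `[0, 1]%classic `<=` (fun s : R =>
    `|u (x + s *: v) - u (y + s *: v)| <= e).
  move/compact_near_coveringP : C => C.
  apply: (C V (nbhs x) (fun y s => `|u (x + s *: v) - u (y + s *: v)| <= e)
    (nbhs_filter x)) => s _.
  have c1 : {for (s, x), continuous (fun z : R * V => x + z.1 *: v)}.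
    apply: (@continuous_comp _ _ _ fst (fun s : R => x + s *: v) (s, x)).
      exact: cvg_fst.
    exact: continuous_line.
  have c2 : {for (s, x), continuous (fun z : R * V => z.2 + z.1 *: v)}.
    exact: continuous_add_scale.
  have e20 : 0 < e / 2 by rewrite divr_gt0.
  have h1 := (@cvgrPdist_le R R (R * V)%type (nbhs (s, x)) (nbhs_filter (s, x))
    _ _).1 (continuous_comp c1 (cu _)) _ e20.
  have h2 := (@cvgrPdist_le R R (R * V)%type (nbhs (s, x)) (nbhs_filter (s, x))
    _ _).1 (continuous_comp c2 (cu _)) _ e20.
  near=> z => /=.
  have H1 : `|u (x + s *: v) - u (x + z.1 *: v)| <= e / 2 by near: z.
  have H2 : `|u (x + s *: v) - u (z.2 + z.1 *: v)| <= e / 2 by near: z.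
  rewrite distrC in H1.
  rewrite (splitr e) -(subrK (u (x + s *: v)) (u (x + z.1 *: v))) -addrA.
  by rewrite (le_trans (ler_normD _ _))// lerD.
apply: filterS => y Hy; rewrite /steklov.
rewrite -RintegralB//; try exact: integrable_line.
apply: le_trans (le_normr_Rintegral _ _) _ => //.
  have := integrableB _ (integrable_line x v 0 1 cu)
    (integrable_line y v 0 1 cu).
  by apply.
have -> : e = \int[leb]_(s in `[0, 1]) e.
  by rewrite Rintegral01_cst.
apply: le_Rintegral => //.
- apply: (@integrable_norm _ _ _ leb `[0, 1]%classic
    (fun s => u (x + s *: v) - u (y + s *: v))).
  have := integrableB _ (integrable_line x v 0 1 cu)
    (integrable_line y v 0 1 cu).
  by apply.
- by apply: (@bounded_by_integrable _ _ _ _ _ _ `|e|) => //; exact: leb01_lty.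
Unshelve. all: by end_near. Qed.

(** Differentiation under the integral sign. *)
Lemma steklov_derive v e u (M : R) x : continuous u ->
  (forall y, derivable u y e) -> (forall y, `|'D_e u y| <= M) ->
  is_derive x e (steklov v u) (steklov v ('D_e u) x).
Proof.
move=> cu du DM.
pose f (t s : R) := u (x + t *: e + s *: v).
have fE t s : f t s = u ((x + s *: v) + t *: e) by rewrite /f addrAC.
have Df (t s : R) : is_derive t 1 (f ^~ s) ('D_e u (x + t *: e + s *: v)).
  rewrite (_ : f ^~ s = fun t : R => u ((x + s *: v) + t *: e)).
    by rewrite addrAC; exact: is_derive_line.
  by apply/funext => r; rewrite fE.
have p1 (t s : R) : partial1of2 f t s = 'D_e u (x + t *: e + s *: v).
  by rewrite partial1of2E; case: (Df t s).
have mD : measurable (`[0, 1]%classic : set R) by exact: measurable_itv.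
have I0 : `](-1), 1[%classic (0 : R) by rewrite /= in_itv/= ltrN10 ltr01.
have intf (t : R) : leb.-integrable `[0, 1] (EFin \o f t)
  by exact: integrable_line.
have df (t s : R) : derivable (f ^~ s) t 1 by case: (Df t s).
have intG : leb.-integrable `[0, 1] (EFin \o (cst `|M|)).
  by apply: (@bounded_by_integrable _ _ _ _ _ _ `|M|) => //=;
    [exact: leb01_lty | move=> y _; rewrite normr_id].
have Gub (t s : R) : `|partial1of2 f t s| <= cst `|M| s.
  by rewrite p1 (le_trans (DM _))// ler_norm.
apply: is_derive_line0.
rewrite (_ : (fun t => _) = (fun t => \int[leb]_(s in `[0, 1]) f t s));
  last by [].
have G0 (y : R) : 0 <= cst `|M| y by exact: normr_ge0.
have H1 := @derivable_under_integral R _ _ leb f _ mD 0 (-1) 1 I0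
  (fun t _ => intf t) (fun t s _ _ => df t s) _ G0 intG
    (fun t s _ _ => Gub t s).
have H2 := @differentiation_under_integral R _ _ leb f _ mD 0 (-1) 1 I0
  (fun t _ => intf t) (fun t s _ _ => df t s) _ G0 intG
    (fun t s _ _ => Gub t s).
apply: DeriveDef; first exact: H1.
rewrite -derive1E; apply: (etrans H2).
rewrite /steklov; apply: eq_Rintegral => s _.
by rewrite p1 scale0r addr0.
Qed.

Lemma steklov_support v u : compactly_supported u ->
  compactly_supported (steklov v u).
Proof.
move=> cu; pose K := (fun z : V * R => z.1 + z.2 *: - v) @`
  (closure [set x | u x != 0] `*` `[0, 1]%classic).
have cK : compact K.
  apply: continuous_compact.
    apply: continuous_subspaceT => z.
    apply: (@continuous_comp _ _ _ (fun z => (z.2, z.1))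
      (fun z : R * V => z.2 + z.1 *: - v) z).
      exact: swap_continuous.
    exact: continuous_add_scale.
  by apply: compact_setX => //; exact: segment_compact.
apply: (compactly_supportedP cK) => x nKx.
rewrite /steklov (eq_Rintegral _ (g := cst 0));
  first by rewrite Rintegral01_cst.
move=> s /set_mem s01 /=; apply: contrapT => /eqP us; apply: nKx.
exists (x + s *: v, s) => /=; last by rewrite scalerN addrK.
by split => //; apply: subset_closure.
Qed.

Lemma partial_steklov v k u : test_fun u ->
  partial k (steklov v u) = steklov v (partial k u).
Proof.
move=> tu; apply/funext => x.
have [M HM] := test_fun_bounded (test_fun_partial k tu).
have := @steklov_derive v (unit_vec k) u M x (test_fun_continuous tu)
  (fun y => @test_fun_derivable R n u k y tu) HM.
by case.
Qed.

Lemma test_fun_steklov v u : test_fun u -> test_fun (steklov v u).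
Proof.
move=> tu; split; last by apply: steklov_support; case: tu.
apply: (@smooth_coind _ _ (fun w => exists2 u, test_fun u & w = steklov v u)).
- by move=> _ [w tw ->]; apply: steklov_continuous; exact: test_fun_continuous.
- move=> _ [w tw ->] k; split.
    move=> x; have [M HM] := test_fun_bounded (test_fun_partial k tw).
    by case: (@steklov_derive v (unit_vec k) w M x (test_fun_continuous tw)
      (fun y => @test_fun_derivable R n w k y tw) HM).
  by exists (partial k w); [exact: test_fun_partial|rewrite partial_steklov].
- by exists u.
Qed.

(** In its own direction, the derivative of a Steklov average is a difference
    quotient. *)
Lemma steklov_FTC k (h : R) u x : test_fun u ->
  h * steklov (h *: unit_vec k) (partial k u) x = u (x + h *: unit_vec k) - u x.
Proof.
move=> tu; rewrite -(@FTC_line R n u x (unit_vec k) h).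
- rewrite RintegralZl//.
  exact: (integrable_line x (h *: unit_vec k) 0 1
    (test_fun_continuous (test_fun_partial k tu))).
- by move=> y; exact: test_fun_derivable.
- exact: (test_fun_continuous (test_fun_partial k tu)).
Qed.

Lemma steklov_diff v w u x : continuous u ->
  steklov v u (x + w) - steklov v u x = steklov v (fun y => u (y + w) - u y) x.
Proof.
move=> cu; rewrite /steklov -RintegralB//; try exact: integrable_line.
by apply: eq_Rintegral => s _; rewrite addrAC.
Qed.

Lemma steklov_ge1 v u x : continuous u ->
  (forall s, 0 <= s <= 1 -> 1 <= u (x + s *: v)) -> 1 <= steklov v u x.
Proof.
move=> cu h.
have <- : \int[leb]_(s in `[0, 1]) 1 = 1 by rewrite Rintegral01_cst.
apply: le_Rintegral => //.
- by apply: (@bounded_by_integrable _ _ _ _ _ _ `|1|) => //; exact: leb01_lty.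
- exact: integrable_line.
Qed.

Lemma norm_Lp_steklov p v u (C : R) : 1 <= p -> continuous u -> 0 <= C ->
  (norm_Lp p u <= C%:E)%E -> (norm_Lp p (steklov v u) <= C%:E)%E.
Proof.
move=> p1 cu C0 uC.
have mu_ := continuous_measurable_rV cu.
rewrite (_ : steklov v u =
  fun x => (1 : R)^-1 * \int[leb]_(s in `[0, 1]) u (x + s *: v)); last first.
  by apply/funext => x; rewrite invr1 mul1r.
apply: (@norm_Lp_average_le R n p p1 _ _ leb 1 `[0, 1]%classic) => //.
- exact: leb01.
- apply: (measurableT_comp mu_); apply: measurable_fun_addrV => //=.
  by apply: measurable_fun_scalerV; exact: measurable_snd.
- by move=> x; exact: integrable_line.
- by move=> s _; rewrite norm_Lp_shift.
Qed.

End steklov.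

(** * Cube averages and a gradient bound on truncations *)

Section translation_estimate.
Context {R : realType} {n : nat}.
Local Notation V := 'rV[R]_n.
Variable p : R.
Hypothesis p1 : 1 <= p.
Implicit Types (u : V -> R) (C : 'I_n -> R).

Lemma measurable_shift u (a : V) : measurable_fun setT u ->
  measurable_fun setT (fun x : V => u (x + a)).
Proof. by move=> mu_; apply: (measurableT_comp mu_);
  exact: measurable_fun_addrV. Qed.

Lemma norm_Lp_diff_le u k (h c : R) : test_fun u -> 0 <= h -> 0 <= c ->
  (norm_Lp p (partial k u) <= c%:E)%E ->
  (norm_Lp p (fun x => u (x + h *: unit_vec k) - u x)%R <= (h * c)%:E)%E.
Proof.
move=> tu h0 c0 uc.
under [X in norm_Lp p X]eq_fun do rewrite -steklov_FTC//.
have tk := test_fun_partial k tu.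
rewrite norm_LpZ//; last exact: (test_fun_measurable (test_fun_steklov _ tk)).
rewrite ger0_norm// EFinM lee_wpmul2l ?lee_fin//.
by apply: norm_Lp_steklov => //; exact: test_fun_continuous.
Qed.

(** Translation along [y], decomposed into translations along the axes. *)
Lemma norm_Lp_diff_sum_le u C (y : V) : test_fun u ->
  (forall k, 0 <= C k) -> (forall k, norm_Lp p (partial k u) <= (C k)%:E)%E ->
  (forall k, 0 <= y ord0 k) ->
  (norm_Lp p (fun x => u (x + y) - u x)%R <= (\sum_k y ord0 k * C k)%:E)%E.
Proof.
move=> tu C0 uC y0.
suff H (s : seq 'I_n) : (norm_Lp p
  (fun x => u (x + \sum_(k <- s) y ord0 k *: unit_vec k) - u x)%R
     <= (\sum_(k <- s) y ord0 k * C k)%:E)%E.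
  rewrite {1}(row_sum_delta y); exact: H.
elim: s => [|k s IH].
  rewrite !big_nil; apply/norm_Lp_leP => //.
  under eq_integral do rewrite addr0 subrr normr0 powR0 ?gt_eqF
    ?(lt_le_trans _ p1)//.
  by rewrite integral0 lee_fin powR_ge0.
rewrite !big_cons.
set w := y ord0 k *: unit_vec k; set Y := \sum_(j <- s) _.
have mu_ := test_fun_measurable tu.
have mw : measurable_fun setT (fun x : V => u (x + w) - u x).
  by apply: measurable_funB => //; exact: measurable_shift.
have -> : (fun x => u (x + (w + Y)) - u x) =
    (fun x => (u (x + Y + w) - u (x + Y)) + (u (x + Y) - u x)).
  by apply/funext => x; rewrite [RHS]addrA subrK -[x + Y + w]addrA [Y + w]addrC.
apply: (le_trans (norm_LpD _ _ _)) => //.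
- exact: (measurable_shift Y mw).
- by apply: measurable_funB => //; exact: measurable_shift.
rewrite EFinD leeD//.
rewrite (@norm_Lp_shift R n p Y (fun x => u (x + w) - u x))//.
exact: norm_Lp_diff_le.
Qed.

End translation_estimate.

Section cube_average.
Context {R : realType} {n : nat}.
Local Notation V := 'rV[R]_n.
Local Notation mu := (lebesgue_rV R n).
Variable p : R.
Hypothesis p1 : 1 <= p.
Implicit Types (u : V -> R) (l : R).

(** The cube with lower corner at the origin and side [l]. *)
Definition cube l : set V := [set v | forall i, v ord0 i \in `[0, l]].

(** The average of [u] over the translate by [x] of [cube l]. *)
Definition cube_avg l u : V -> R :=
  fun x => (l ^+ n)^-1 * \int[mu]_(y in cube l) u (x + y).

Lemma measurable_cube l : measurable (cube l).
Proof. exact: (@measurable_box R n (fun=> `[0, l]%classic)). Qed.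

Lemma lebesgue_cube l : 0 < l -> mu (cube l) = (l ^+ n)%:E.
Proof.
move=> l0; rewrite (@lebesgue_rV_box R n (fun=> `[0, l]%classic))//.
under eq_bigr do rewrite lebesgue_measure_itv/= lte_fin l0 oppr0 adde0.
by rewrite prodEFin prodr_const card_ord.
Qed.

Lemma lebesgue_cube_lty l : 0 < l -> (mu (cube l) < +oo)%E.
Proof. by move=> l0; rewrite lebesgue_cube// ltry. Qed.

Lemma measurable_shiftl u (x : V) : measurable_fun setT u ->
  measurable_fun setT (fun y : V => u (x + y)).
Proof. by move=> mu_; apply: (measurableT_comp mu_);
  exact: measurable_fun_addrV. Qed.

Lemma integrable_cube l u x M : 0 < l -> measurable_fun setT u ->
  (forall x, `|u x| <= M) ->
  mu.-integrable (cube l) (EFin \o (fun y => u (x + y))).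
Proof.
move=> l0 mu_ uM; apply: (@bounded_by_integrable _ _ _ _ _ _ M) => //.
- exact: measurable_cube.
- exact: lebesgue_cube_lty.
- by apply: measurable_funTS; exact: measurable_shiftl.
Qed.

Lemma cube_avg_cst l (c : R) x : 0 < l -> cube_avg l (cst c) x = c.
Proof.
move=> l0; rewrite /cube_avg Rintegral_cst; last exact: measurable_cube.
rewrite [X in fine X](lebesgue_cube l0)/=; field.
by rewrite expf_neq0// gt_eqF.
Qed.

Lemma cube_avg_bounded l u M x : 0 < l -> measurable_fun setT u ->
  (forall x, `|u x| <= M) -> `|cube_avg l u x| <= M.
Proof.
move=> l0 mu_ uM; rewrite /cube_avg normrM.
have iu := integrable_cube x l0 mu_ uM.
rewrite ger0_norm ?invr_ge0 ?exprn_ge0 ?(ltW l0)//.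
rewrite -[leRHS](cube_avg_cst M x l0) /cube_avg ler_pM2l ?invr_gt0 ?exprn_gt0//.
apply: le_trans (le_normr_Rintegral _ iu) _; first exact: measurable_cube.
apply: le_Rintegral => //.
- exact: measurable_cube.
- exact: integrable_norm.
- apply: (@bounded_by_integrable _ _ _ _ _ _ `|M|) => //.
    exact: measurable_cube.
  exact: lebesgue_cube_lty.
Qed.

Lemma cube_avgB l u (v : V -> R) (M N : R) x : 0 < l ->
  measurable_fun setT u -> measurable_fun setT v ->
  (forall x, `|u x| <= M) -> (forall x, `|v x| <= N) ->
  cube_avg l (fun y => u y - v y) x = cube_avg l u x - cube_avg l v x.
Proof.
move=> l0 mu_ mv uM vN; rewrite /cube_avg -mulrBr RintegralB//.
- exact: measurable_cube.
- exact: integrable_cube uM.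
- exact: integrable_cube vN.
Qed.

Lemma measurable_cube_avg l u : measurable_fun setT u ->
  measurable_fun setT (cube_avg l u).
Proof.
move=> mu_; apply: measurable_funM; first exact: measurable_cst.
apply: (@measurable_average R n _ V mu (cube l) _ (fun x y => u (x + y))).
  exact: measurable_cube.
by apply: (measurableT_comp mu_); exact: measurable_fun_addrV.
Qed.

Lemma cube_avg_Lp_bound l u M (c : R) x : 0 < l -> measurable_fun setT u ->
  (forall x, `|u x| <= M) -> 0 <= c -> (norm_Lp p u <= c%:E)%E ->
  `|cube_avg l u x| <= l `^ (- (n%:R / p)) * c.
Proof.
move=> l0 mu_ uM c0 uc.
have p0 : 0 < p by exact: lt_le_trans p1.
have ln0 : 0 < l ^+ n by rewrite exprn_gt0.
suff H : `|cube_avg l u x| `^ p <= (l `^ (- (n%:R / p)) * c) `^ p.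
  rewrite leNgt; apply/negP => /(gt0_ltr_powR p0).
  rewrite ltNge H => /(_ _ _)/negP; apply; rewrite ?nnegrE//.
  by rewrite mulr_ge0// powR_ge0.
rewrite powRM ?powR_ge0// -powRrM.
have -> : l `^ (- (n%:R / p) * p) = (l ^+ n)^-1.
  by rewrite mulNr divfK ?gt_eqF// powRN powR_mulrn// ltW.
rewrite -lee_fin.
apply: (le_trans (jensen_powR p1 ln0 (measurable_cube l) (lebesgue_cube l0)
  (integrable_cube x l0 mu_ uM))).
rewrite EFinM lee_wpmul2l ?lee_fin ?invr_ge0 ?(ltW ln0)//.
move/(norm_Lp_leP p1 _ c0) : uc; apply: le_trans.
rewrite -(@norm_Lp_powR R n p p1) -(norm_Lp_shift p x)// norm_Lp_powR//.
rewrite integral_mkcond; apply: ge0_le_integral_pointwise => y _.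
  by rewrite patchE; case: ifP => // _; rewrite lee_fin powR_ge0.
rewrite patchE; case: ifP => _; last by rewrite lee_fin powR_ge0.
by rewrite addrC.
Qed.

Lemma norm_Lp_sub_cube_avg l u (C : 'I_n -> R) : 0 < l -> test_fun u ->
  (forall k, 0 <= C k) -> (forall k, norm_Lp p (partial k u) <= (C k)%:E)%E ->
  (norm_Lp p (fun x => u x - cube_avg l u x)%R <= (l * \sum_k C k)%:E)%E.
Proof.
move=> l0 tu C0 uC.
have [M uM] := test_fun_bounded tu; have mu_ := test_fun_measurable tu.
have -> : (fun x => u x - cube_avg l u x) =
    (fun x => (l ^+ n)^-1 * \int[mu]_(y in cube l) (u x - u (x + y))).
  apply/funext => x; rewrite RintegralB.
  - by rewrite mulrBr -[in LHS](cube_avg_cst (u x) x l0).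
  - exact: measurable_cube.
  - apply: (@bounded_by_integrable _ _ _ _ _ _ `|u x|) => //.
      exact: measurable_cube.
    exact: lebesgue_cube_lty.
  - exact: integrable_cube uM.
apply: (@norm_Lp_average_le R n p p1 _ V mu (l ^+ n) (cube l) _ _ _
  (fun x y => u x - u (x + y))).
- by rewrite exprn_gt0.
- exact: measurable_cube.
- exact: lebesgue_cube.
- apply: measurable_funB; first exact: (measurableT_comp mu_).
  by apply: (measurableT_comp mu_); exact: measurable_fun_addrV.
- move=> x; apply: (@bounded_by_integrable _ _ _ _ _ _ (M + M)).
  + exact: measurable_cube.
  + exact: lebesgue_cube_lty.
  + apply: measurable_funTS; apply: measurable_funB => //.
    exact: measurable_shiftl.
  + by move=> y _; rewrite (le_trans (ler_normB _ _))// lerD.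
- by rewrite mulr_ge0 ?sumr_ge0// ltW.
- move=> y ly.
  have -> : norm_Lp p (fun x => u x - u (x + y)) = norm_Lp p
    (fun x => u (x + y) - u x).
    rewrite !norm_LpE; congr (_ `^ _)%E; apply: eq_integral => x _.
    by rewrite distrC.
  apply: le_trans (norm_Lp_diff_sum_le p1 tu C0 uC _) _.
    by move=> k; have := ly k; rewrite in_itv/= => /andP[].
  rewrite lee_fin mulr_sumr; apply: ler_sum => k _; rewrite ler_wpM2r//.
  by have := ly k; rewrite in_itv/= => /andP[].
Qed.

Lemma pow2_ge (N : nat) : (N%:R : R) <= 2 ^+ N.
Proof. by rewrite -natrX ler_nat ltnW// ltn_expl. Qed.

(** The dyadic iteration: the average at scale [l] is an average of the one at
    scale [2 * l] up to an error of order [l `^ (1 - n%:R / p)].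
    After [N] steps the remainder is controlled by the L^p norm of [u]. *)
Lemma cube_avg_iter u (C : 'I_n -> R) (F : R) (N : nat) l x : test_fun u ->
  (forall k, 0 <= C k) -> (forall k, norm_Lp p (partial k u) <= (C k)%:E)%E ->
  0 <= F -> (norm_Lp p u <= F%:E)%E -> p < n%:R -> 0 < l ->
  `|cube_avg l u x| <=
    (2 * \sum_k C k) / (1 - 2 `^ (1 - n%:R / p)) * l `^ (1 - n%:R / p) +
      (2 ^+ N)^-1 * l `^ (- (n%:R / p)) * F.
Proof.
move=> tu C0 uC F0 uF pn l0; set b := n%:R / p.
have p0 : 0 < p by exact: lt_le_trans p1.
have b1 : 1 < b by rewrite ltr_pdivlMr// mul1r.
have sC0 : 0 <= \sum_k C k by exact: sumr_ge0.
set a := \sum_k C k in sC0 *.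
have mu_ := test_fun_measurable tu; have [M uM] := test_fun_bounded tu.
set r := (2 : R) `^ (1 - b).
have r0 : 0 < r by exact: powR_gt0.
have r1 : r < 1.
  rewrite /r -opprB powRN invf_lt1 ?powR_gt0//.
  have : (1 : R) `^ (b - 1) < 2 `^ (b - 1).
    by rewrite gt0_ltr_powR ?nnegrE ?subr_gt0 ?ltr1n.
  by rewrite powR1.
have powB (y : R) : 0 < y -> y `^ (1 - b) = y * y `^ (- b).
  by move=> y0; rewrite powRD ?powRr1 ?(ltW y0)// (gt_eqF y0) implybT.
have rE : (2 : R) `^ (- b) = r / 2.
  by rewrite /r powB// mulrC mulKf.
set Q := 2 * a / (1 - r).
have Q0 : 0 <= Q by rewrite divr_ge0 ?mulr_ge0 ?subr_ge0 ?(ltW r1).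
have QE : 2 * a + Q * r = Q by rewrite /Q; field; rewrite subr_eq0 gt_eqF.
elim: N l l0 x => [|N IH] l l0 x.
  rewrite expr0 invr1 mul1r.
  apply: le_trans (cube_avg_Lp_bound x l0 mu_ uM F0 uF) _.
  by rewrite lerDr mulr_ge0// powR_ge0.
have l20 : 0 < 2 * l by rewrite mulr_gt0.
pose v := cube_avg (2 * l) u.
have vM y : `|v y| <= M by exact: cube_avg_bounded.
have mv : measurable_fun setT v by exact: measurable_cube_avg.
have wM y : `|u y - v y| <= M + M by rewrite (le_trans (ler_normB _ _))// lerD.
have mw : measurable_fun setT (fun y => u y - v y) by exact: measurable_funB.
(* The first term is estimated in L^p, the second one by the supremum of [v]. *)
have -> : cube_avg l u x = cube_avg l (fun y => u y - v y) x + cube_avg l v x.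
  by rewrite (cube_avgB x l0 mu_ mv uM vM) subrK.
apply: (le_trans (ler_normD _ _)).
have H1 : `|cube_avg l (fun y => u y - v y) x| <= l `^ (- b) * (2 * l * a).
  apply: (cube_avg_Lp_bound x l0 mw wM); first by rewrite !mulr_ge0// ltW.
  exact: norm_Lp_sub_cube_avg.
have H2 : `|cube_avg l v x| <= Q * (2 * l) `^ (1 - b) + (2 ^+ N)^-1 * (2 * l)
  `^ (- b) * F.
  by apply: cube_avg_bounded => // y; exact: IH.
apply: (le_trans (lerD H1 H2)).
rewrite !powRM ?(ltW l0)// -/r rE [l `^ (1 - b)]powB// exprS invfM.
have P0 := powR_ge0 l (- b).
set P := l `^ (- b) in P0 *.
have K0 : 0 <= (2 ^+ N)^-1 * P * F by rewrite !mulr_ge0// invr_ge0 exprn_ge0.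
set K := (2 ^+ N)^-1 in K0 *.
have -> : P * (2 * l * a) + (Q * (r * (l * P)) + K * (r / 2 * P) * F) =
   (2 * a + Q * r) * (l * P) + r / 2 * (K * P * F) by field.
rewrite QE lerD2l (_ : 2^-1 * K * P * F = 2^-1 * (K * P * F)); last by ring.
rewrite ler_wpM2r//; lra.
Qed.

(** The dyadic iteration with [N] tending to infinity. *)
Lemma cube_avg_sup_bound u (C : 'I_n -> R) l x : test_fun u ->
  (forall k, 0 <= C k) -> (forall k, norm_Lp p (partial k u) <= (C k)%:E)%E ->
  p < n%:R -> 0 < l ->
  `|cube_avg l u x| <=
    (2 * \sum_k C k) / (1 - 2 `^ (1 - n%:R / p)) * l `^ (1 - n%:R / p).
Proof.
move=> tu C0 uC pn l0; set b := n%:R / p.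
have := norm_Lp_test_fin p1 tu; have := norm_Lp_ge0 p u.
case E : (norm_Lp p u) => [F| |]// F0 _; rewrite lee_fin in F0.
have uF : (norm_Lp p u <= F%:E)%E by rewrite E.
have H N := @cube_avg_iter u C F N l x tu C0 uC F0 uF pn l0.
rewrite -/b in H *.
set X := `|_| in H *; set Y := _ * _ in H *.
rewrite leNgt; apply/negP => YX.
pose c := l `^ (- b) * F.
have c0 : 0 <= c by rewrite mulr_ge0// powR_ge0.
have XY : 0 < X - Y by rewrite subr_gt0.
(* The remainder is at most [c / 2 ^ N], and [2 ^ N >= N]. *)
have [N HN] : exists N : nat, c / (X - Y) < N%:R.
  by exists (Num.bound (c / (X - Y))); rewrite archi_boundP// divr_ge0// ltW.
have := H N; rewrite -/b -mulrA -/c -/Y -lerBlDl; apply/negP; rewrite -ltNge.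
rewrite mulrC ltr_pdivrMr ?exprn_gt0// mulrC -ltr_pdivrMr//.
exact: lt_le_trans HN (pow2_ge N).
Qed.

(** A form of the Sobolev inequality: the L^p norm of the positive part of
    [u - eps] is controlled by the gradient alone.  The constant [M] depends
    only on [eps] and on the bound [a] on the gradient. *)
Lemma truncation_Lp_bound (eps a : R) : p < n%:R -> 0 < eps -> 0 <= a ->
  exists2 M : R, 0 <= M & forall u, test_fun u ->
    (sobolev_seminorm p u <= a%:E)%E ->
    (norm_Lp p (fun x => Num.max 0 (u x - eps))%R <= M%:E)%E.
Proof.
move=> pn e0 a0; have p0 : 0 < p by exact: lt_le_trans p1.
pose b := n%:R / p.
have b1 : 1 < b by rewrite ltr_pdivlMr// mul1r.
have b10 : 0 < b - 1 by rewrite subr_gt0.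
pose Q := `|2 * a / (1 - 2 `^ (1 - b))|.
have Q0 : 0 <= Q by exact: normr_ge0.
pose s := Q / eps + 1.
have s0 : 0 < s by rewrite ltr_wpDl// divr_ge0// ltW.
(* With this side, [l `^ (1 - b) = s^-1], so the averages are at most [eps]. *)
pose l := s `^ (b - 1)^-1.
have l0 : 0 < l by exact: powR_gt0.
have lE : l `^ (1 - b) = s^-1.
  rewrite /l -powRrM -[1 - b]opprB mulrN mulVf ?gt_eqF// powRN powRr1//;
    exact: ltW.
exists (l * a); first by rewrite mulr_ge0// ltW.
move=> u tu ua.
pose C k := fine (norm_Lp p (partial k u)).
have CE k : norm_Lp p (partial k u) = (C k)%:E.
  rewrite /C fineK// ge0_fin_numE ?norm_Lp_ge0//.
  exact: (norm_Lp_test_fin p1 (test_fun_partial k tu)).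
have C0 k : 0 <= C k by rewrite -lee_fin -CE norm_Lp_ge0.
have uC k : (norm_Lp p (partial k u) <= (C k)%:E)%E by rewrite CE.
have Ca : \sum_k C k <= a.
  by move: ua; rewrite /sobolev_seminorm (eq_bigr (fun k => (C k)%:E))//
    sumEFin lee_fin.
have sup x : `|cube_avg l u x| <= eps.
  apply: (le_trans (cube_avg_sup_bound x tu C0 uC pn l0)).
  rewrite -/b lE ler_pdivrMr// /s mulrDr mulr1 mulrCA divff ?gt_eqF// mulr1.
  apply: (@le_trans _ _ Q); last by rewrite lerDl ltW.
  apply: (le_trans (ler_norm _)); rewrite /Q !normrM ler_wpM2r// ler_wpM2l//.
  by rewrite !ger0_norm// sumr_ge0.
apply: (@le_trans _ _ (norm_Lp p (fun x => u x - cube_avg l u x)%R)).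
  apply: norm_Lp_le => // x;
    rewrite ger0_norm ?le_max ?lexx// ge_max normr_ge0/=.
  apply: le_trans (ler_norm _); rewrite lerD2l lerN2.
  by apply: le_trans (sup x); exact: ler_norm.
apply: le_trans (norm_Lp_sub_cube_avg l0 tu C0 uC) _.
by rewrite lee_fin ler_pM2l.
Qed.

End cube_average.

(** * A smooth cutoff with derivative close to 1 *)

Section flat_functions.
Context {R : realType}.
Implicit Types (P : {poly R}) (x y : R).

(** The functions [P(1/x) exp(-1/x)] extended by 0 to [x <= 0].  They form a
    class that is stable under differentiation. *)
Definition flat P x : R := if 0 < x then P.[x^-1] * expR (- x^-1) else 0.

Lemma expR_ge_pow (m : nat) y : (0 < m)%N -> 0 <= y ->
  y ^+ m <= m%:R ^+ m * expR y.
Proof.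
move=> m0 y0; have mp : 0 < (m%:R : R) by rewrite ltr0n.
have -> : expR y = expR (y / m%:R) ^+ m.
  by rewrite -expRM_natl mulrC divfK// gt_eqF.
rewrite -exprMn lerXn2r ?nnegrE ?mulr_ge0 ?expR_ge0 ?(ltW mp)//.
rewrite mulrC -ler_pdivrMr//; apply: le_trans (expR_ge1Dx _).
by rewrite lerDr.
Qed.

Lemma horner_norm_bound P : exists2 S : R, 0 <= S &
  forall y, 1 <= y -> `|P.[y]| <= S * y ^+ (size P).
Proof.
exists (\sum_(i < size P) `|P`_i|); first exact: sumr_ge0.
move=> y y1; have y0 : 0 <= y by exact: le_trans y1.
rewrite horner_coef (le_trans (ler_norm_sum _ _ _))// mulr_suml.
apply: ler_sum => i _; rewrite normrM ler_wpM2l// normrX ger0_norm//.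
by rewrite ler_weXn2l// ltnW.
Qed.

(** Quadratic vanishing at 0. *)
Lemma flat_bound P : exists2 S : R, 0 <= S &
  forall x, `|x| <= 1 -> `|flat P x| <= S * x ^+ 2.
Proof.
have [S S0 HS] := horner_norm_bound P.
(* Two more powers than needed to absorb [P(1/x)] leave a factor [x ^+ 2]. *)
have [m mE] : exists m, m = (size P + 2)%N by exists (size P + 2)%N.
have m0 : (0 < m)%N by rewrite mE addn2.
exists (S * m%:R ^+ m); first by rewrite mulr_ge0// exprn_ge0.
move=> x x1; rewrite /flat; case: ifPn => [x0|_]; last first.
  by rewrite normr0 mulr_ge0 ?sqr_ge0// mulr_ge0// exprn_ge0.
move: x1; rewrite gtr0_norm// => x1.
have y1 : 1 <= x^-1 by rewrite invf_ge1.
have y0 : 0 <= x^-1 by exact: le_trans y1.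
rewrite normrM (ger0_norm (expR_ge0 _)) expRN.
have xe : x != 0 by rewrite gt_eqF.
rewrite ler_pdivrMr ?expR_gt0//; apply: (le_trans (HS _ y1)).
rewrite (_ : _ * expR _ = S * (m%:R ^+ m * (x ^+ 2 * expR x^-1)));
  last by rewrite !mulrA.
rewrite ler_wpM2l//.
have -> : x^-1 ^+ size P = x ^+ 2 * x^-1 ^+ m.
  by rewrite mE exprD mulrCA -exprMn divff// expr1n mulr1.
by rewrite [leRHS]mulrCA ler_wpM2l ?sqr_ge0// expR_ge_pow.
Qed.

Lemma is_derive_flat P x :
  is_derive x 1 (flat P) (flat ('X^2 * (P - P^`())) x).
Proof.
have [x0|x0|->] := ltgtP x 0.
- have E : \forall y \near x, cst 0 y = flat P y.
    near=> y; rewrite /flat ifN// -leNgt ltW//; near: y.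
    exact: lt_nbhsl.
  have -> : flat ('X^2 * (P - P^`())) x = 0 by rewrite /flat ifN// -leNgt ltW.
  apply: (@near_eq_is_derive _ _ _ (cst 0) _ _ _ _ E).
- have E : \forall y \near x, (P.[y^-1] * expR (- y^-1)) = flat P y.
    near=> y; rewrite /flat ifT//; near: y; exact: lt_nbhsr.
  apply: (near_eq_is_derive E).
  have xe : x != 0 by rewrite gt_eqF.
  have D1 : is_derive x 1 (fun y : R => y^-1) (- x ^- 2).
    by rewrite -[X in is_derive _ _ _ X]mulr1; exact: (is_deriveV (f := id)).
  have Dh : is_derive x^-1 1 (horner P) (P^`().[x^-1]).
    by rewrite derivE derive1E; apply: DeriveDef => //; exact: derivable_horner.
  have D2 := is_derive1_comp Dh D1.
  have D3 := is_derive1_comp (g := fun y : R => - y^-1)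
    (is_derive_expR (- x^-1)) (is_deriveN D1).
  have [D4 D5] := is_deriveM D2 D3; apply: DeriveDef; first exact: D4.
  apply: (etrans D5); rewrite /flat x0 hornerM hornerD hornerN hornerXn /=.
  rewrite /GRing.scale /=; set A := expR _; set B := P.[_]; set C := _.[_].
  by field.
- have flat0 Q : flat Q 0 = 0 by rewrite /flat ltxx.
  rewrite flat0; have [S S0 HS] := flat_bound P.
  suff H : (fun h : R => h^-1 *:
    ((flat P \o shift 0) (h *: (1 : R)) - flat P 0)) @ 0^' --> (0 : R).
    by apply: DeriveDef; [apply/cvg_ex; exists 0|apply: cvg_lim].
  apply/cvgrPdist_le => e e0; near=> h.
  have h0 : h != 0 by near: h; exact: nbhs_dnbhs_neq.
  have h1 : `|h| <= 1 by near: h; exact: dnbhs0_le.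
  have h2 : `|h| <= e / (S + 1).
    by near: h; apply: dnbhs0_le; rewrite divr_gt0// ltr_wpDl.
  rewrite sub0r normrN flat0 subr0 /= addr0 [h%:A]mulr1 normrM normfV.
  rewrite ler_pdivrMl ?normr_gt0//; apply: (le_trans (HS _ h1)).
  have -> : S * h ^+ 2 = `|h| * (S * `|h|).
    by rewrite -[h ^+ 2]real_normK ?num_real//; ring.
  rewrite ler_wpM2l//.
  move: h2; rewrite ler_pdivlMr ?ltr_wpDl// => h2.
  by have := normr_ge0 h; nra.
Unshelve. all: by end_near. Qed.

End flat_functions.

Section cutoff.
Context {R : realType}.

Lemma is_derive_mull (k : R) (g : R -> R) (t d : R) : is_derive t 1 g d ->
  is_derive t 1 (fun t => k * g t) (k * d).
Proof.
move=> dg; have [D1 D2] := is_deriveM (is_derive_cst k t 1) dg.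
apply: DeriveDef; first exact: D1.
by apply: (etrans D2); rewrite scaler0 addr0.
Qed.

Lemma is_derive_subr (a t : R) : is_derive t 1 (fun t => t - a) 1.
Proof.
have [D1 D2] := is_deriveB (is_derive_id t 1) (is_derive_cst a t 1).
by apply: DeriveDef; [exact: D1|apply: (etrans D2); rewrite subr0].
Qed.

(** The function [Phi 0] is [c (t - eps) exp(- eps / (t - eps))] for [t > eps]
    and 0 otherwise, and [Phi j] is its [j]-th derivative. *)
Lemma smooth_cutoff (c : R) : 1 < c ->
  exists2 eps : R, 0 < eps & exists Phi : nat -> R -> R,
  [/\ forall j t, is_derive (t : R) 1 (Phi j) (Phi j.+1 t),
      forall t, `|Phi 1%N t| <= c,
      forall t, `|Phi 0%N t| <= c * Num.max 0 (t - eps) &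
      forall t, 1 <= t -> 1 <= Phi 0%N t].
Proof.
move=> c1; have c0 : 0 < c by exact: lt_trans c1.
have cn : c != 0 by rewrite gt_eqF.
(* This choice gives [c * (1 - 2 * eps) = 1], which is used with
   [expR (- y) >= 1 - y] to bound [Phi 0] below by 1 for [t >= 1]. *)
pose eps := (1 - c^-1) / 2.
have e0 : 0 < eps by rewrite divr_gt0// subr_gt0 invf_lt1.
have en : eps != 0 by rewrite gt_eqF.
have ce : c * (1 - 2 * eps) = 1 by rewrite /eps; field.
exists eps => //.
pose Ps := fix Ps j : {poly R} :=
  if j is j'.+1 then 'X^2 * (Ps j' - (Ps j')^`()) else 1 + 'X.
pose w (t : R) := (t - eps) / eps.
pose Phi (j : nat) (t : R) : R :=
  if j is j'.+1 then c * (eps ^- j' * flat (Ps j') (w t))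
  else c * (t - eps) * flat 1 (w t).
have dw (t : R) : is_derive t 1 w eps^-1.
  rewrite (_ : w = fun t => eps^-1 * (t - eps)); last first.
    by apply/funext => u; rewrite /w mulrC.
  by rewrite -[X in is_derive _ _ _ X]mulr1; apply: is_derive_mull;
    exact: is_derive_subr.
have dflat P (t : R) : is_derive t 1 (fun t => flat P (w t))
  (flat ('X^2 * (P - P^`())) (w t) * eps^-1).
  by apply: (is_derive1_comp (f := flat P)); exact: is_derive_flat.
have wpos t : (0 < w t) = (eps < t) by rewrite /w pmulr_lgt0 ?invr_gt0//
  subr_gt0.
exists Phi; split.
- case=> [|j] t.
    have D1 : is_derive t 1 (fun t => c * (t - eps)) (c * 1).
      by apply: is_derive_mull; exact: is_derive_subr.
    have [D2 D3] := is_deriveM D1 (dflat 1 t).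
    apply: DeriveDef; first exact: D2.
    apply: (etrans D3); rewrite /Phi /= /GRing.scale/= expr0 invr1 mul1r /flat
      wpos.
    case: ifPn => [et|_]; last by rewrite !(mul0r, mulr0) addr0.
    have tn : t - eps != 0 by rewrite gt_eqF// subr_gt0.
    have h1 (y : R) : (('X^2 : {poly R}) * (1 - 1^`())).[y] = y ^+ 2.
      by rewrite derivC subr0 mulr1 hornerXn.
    rewrite h1 hornerD hornerX hornerC /w; set E := expR _.
    by field; rewrite tn en.
  have := is_derive_mull c (is_derive_mull (eps ^- j) (dflat (Ps j) t)).
  rewrite (_ : _ * (_ * _) = Phi j.+2 t)//.
  have eS : eps ^- j.+1 = eps ^- j * eps^-1 by rewrite -invfM -exprSr.
  by rewrite /Phi eS; set F := flat _ _; set G := eps ^- j; set H := eps^-1;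
    ring.
- move=> t; rewrite /Phi /= expr0 invr1 mul1r normrM gtr0_norm// -[leRHS]mulr1.
  rewrite ler_pM2l// /flat; case: ifPn => [w0|_]; last by rewrite normr0.
  have y0 : 0 <= (w t)^-1 by rewrite invr_ge0 ltW.
  rewrite !hornerE ger0_norm; last by rewrite mulr_ge0 ?expR_ge0// addr_ge0.
  by rewrite expRN ler_pdivrMr ?expR_gt0// mul1r expR_ge1Dx.
- move=> t; rewrite /Phi /flat wpos; case: ifPn => [et|]; last first.
    by rewrite mulr0 normr0 mulr_ge0 ?(ltW c0)// le_max lexx.
  have te : 0 < t - eps by rewrite subr_gt0.
  rewrite max_r ?(ltW te)// hornerC mul1r ger0_norm; last first.
    by rewrite !mulr_ge0 ?expR_ge0// ltW.
  rewrite ler_piMr ?mulr_ge0 ?(ltW te) ?(ltW c0)//.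
  rewrite -expR0 ler_expR oppr_le0 invr_ge0 ltW// wpos.
  by [].
- move=> t t1; have e1 : eps < 2^-1.
    by have ci : 0 < c^-1 by [rewrite invr_gt0]; rewrite /eps; lra.
  have et : eps < t by apply: lt_le_trans t1; lra.
  have te : 0 < t - eps by rewrite subr_gt0.
  rewrite /Phi /flat wpos et hornerC mul1r.
  apply: (@le_trans _ _ (c * (t - eps) * (1 - (w t)^-1))).
    rewrite /w invf_div -mulrA mulrBr mulr1 mulrCA divff ?gt_eqF// mulr1.
    by rewrite -[leLHS]ce ler_pM2l//; lra.
  by rewrite ler_wpM2l ?mulr_ge0 ?(ltW te) ?(ltW c0)// expR_ge1Dx.
Qed.

End cutoff.

(** * Integrals of powers *)

Section power_integrals.
Context {R : realType}.
Local Notation leb := (@lebesgue_measure R).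

Lemma measurable_powR_fun (s : R) (D : set R) : measurable_fun D
  (fun t : R => t `^ s).
Proof. by apply: (@measurableT_comp _ _ _ _ _ _ (@powR R ^~ s)). Qed.

Lemma measurable_powR_EFin (s : R) (D : set (measurableTypeR R)) :
  measurable_fun D (fun t : measurableTypeR R => (t `^ s)%:E).
Proof. by apply/measurable_EFinP; exact: measurable_powR_fun. Qed.

Lemma integral_powR_itv (s x y : R) : s != 0 -> 0 < x -> x < y ->
  (\int[leb]_(t in `[x, y]) (t `^ (s - 1))%:E = ((y `^ s - x `^ s) / s)%:E)%E.
Proof.
move=> s0 x0 xy.
have dF (t : R) : 0 < t ->
  is_derive t 1 (fun t => s^-1 * t `^ s) (t `^ (s - 1)).
  move=> t0; have := is_derive_mull s^-1 (is_derive1_powR s t0).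
  by rewrite mulrA mulVf// mul1r.
have cpow r (t : R) : 0 < t -> {for t, continuous (fun t : R => t `^ r)}.
  move=> t0; apply/differentiable_continuous/derivable1_diffP.
  by case: (is_derive1_powR r t0).
have cF (t : R) : 0 < t -> {for t, continuous (fun t : R => s^-1 * t `^ s)}.
  by move=> t0; apply/differentiable_continuous/derivable1_diffP;
    case: (dF t t0).
rewrite (@continuous_FTC2 _ _ (fun t => s^-1 * t `^ s))//.
- by rewrite -EFinB -mulrBr mulrC.
- apply: continuous_in_subspaceT => t /set_mem; rewrite /= in_itv/= =>
    /andP[xt _].
  by apply: cpow; exact: lt_le_trans xt.
- split.
  + by move=> t; rewrite in_itv/= => /andP[xt _]; case: (dF t (lt_trans x0 xt)).
  + by apply: cvg_at_right_filter; exact: cF.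
  + by apply: cvg_at_left_filter; apply: cF; exact: lt_trans xy.
- move=> t; rewrite in_itv/= => /andP[xt _].
  by rewrite derive1E; case: (dF t (lt_trans x0 xt)).
Qed.

(** Monotone convergence along an increasing sequence of sets covering [D]. *)
Lemma ge0_integral_bigcup_le (f : measurableTypeR R -> \bar R)
    (D : set (measurableTypeR R)) (F : (set (measurableTypeR R))^nat)
      (C : \bar R) :
  measurable_fun setT f -> (forall x, 0 <= f x)%E ->
  measurable D -> nondecreasing_seq F -> (forall i, measurable (F i)) ->
  D `<=` \bigcup_i F i -> (forall i, \int[leb]_(x in F i) f x <= C)%E ->
  (\int[leb]_(x in D) f x <= C)%E.
Proof.
move=> mf f0 mD ndF mF DF FC.
apply: (@le_trans _ _ (\int[leb]_(x in \bigcup_i F i) f x)%E).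
  apply: ge0_subset_integral => //; first exact: bigcup_measurable.
  exact: measurable_funTS.
have cv := @ge0_nondecreasing_set_cvg_integral _ _ _ F f leb ndF mF
  (fun i => measurable_funTS mf) (fun i x _ => f0 x).
rewrite -(cvg_lim _ cv)//; apply: lime_le; first by apply/cvg_ex; eexists;
  exact: cv.
exact: nearW.
Qed.

Lemma integral_powR_01_le (a : R) : 0 < a ->
  (\int[leb]_(t in `]0%R, 1%R]) (t `^ (a - 1))%:E <= (a^-1)%:E)%E.
Proof.
move=> a0.
apply: (@ge0_integral_bigcup_le _ _ (fun i => `[i.+2%:R^-1, 1]%classic)) => //.
- exact: measurable_powR_EFin.
- by move=> x; rewrite lee_fin powR_ge0.
- move=> i j ij; rewrite subsetEset => t /=; rewrite !in_itv/= => /andP[h ->].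
  by rewrite andbT (le_trans _ h)// lef_pV2 ?posrE// ler_nat.
- move=> t /=; rewrite in_itv/= => /andP[t0 t1].
  exists (Num.bound t^-1) => //=; rewrite in_itv/= t1 andbT.
  rewrite -[leRHS]invrK lef_pV2 ?posrE ?invr_gt0//.
  have := archi_boundP (ltW (_ : 0 < t^-1)); rewrite invr_gt0 => /(_ t0)/ltW h.
  by apply: le_trans h _; rewrite ler_nat -addn2 leq_addr.
- move=> i; rewrite integral_powR_itv ?gt_eqF// ?invf_lt1 ?ltr1n//.
  rewrite lee_fin powR1 ler_pdivrMr// mulVf ?gt_eqF// lerBlDr lerDl.
Qed.

Lemma integral_powR_1y_le (b : R) : 0 < b ->
  (\int[leb]_(t in `]1%R, +oo[) (t `^ (- b - 1))%:E <= (b^-1)%:E)%E.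
Proof.
move=> b0.
apply: (@ge0_integral_bigcup_le _ _ (fun i => `[1, i.+2%:R]%classic)) => //.
- exact: measurable_powR_EFin.
- by move=> x; rewrite lee_fin powR_ge0.
- move=> i j ij; rewrite subsetEset => t /=; rewrite !in_itv/= => /andP[-> h].
  by rewrite (le_trans h)// ler_nat.
- move=> t /=; rewrite in_itv/= andbT => t1.
  exists (Num.bound t) => //=; rewrite in_itv/= (ltW t1)/=.
  have t0 : 0 <= t by rewrite (le_trans _ (ltW t1)).
  have /ltW h := archi_boundP t0.
  by apply: le_trans h _; rewrite ler_nat -addn2 leq_addr.
- move=> i; rewrite integral_powR_itv ?oppr_eq0 ?gt_eqF// ?ltr1n//.
  rewrite lee_fin powR1 invrN mulrN -mulNr opprB ler_pdivrMr// mulVf ?gt_eqF//.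
Qed.

Lemma integral_powR_0d_ge (a delta e : R) : 0 < a -> 0 < delta -> 0 < e ->
  exists2 eta : R, 0 < eta < delta &
    ((delta `^ a / a - e)%:E <= \int[leb]_(t in `[eta, delta])
      (t `^ (a - 1))%:E)%E.
Proof.
move=> a0 d0 e0.
(* Removing [t <= eta] from the integral costs [eta `^ a / a <= e]. *)
pose eta := Num.min (delta / 2) ((a * e) `^ a^-1).
have eta0 : 0 < eta by rewrite lt_min divr_gt0// powR_gt0// mulr_gt0.
have etad : eta < delta.
  by rewrite gt_min; apply/orP; left;
    rewrite ltr_pdivrMr// mulr_natr mulr2n ltrDl.
exists eta; first by rewrite eta0.
rewrite integral_powR_itv ?gt_eqF// lee_fin mulrBl lerD2l lerN2 ler_pdivrMr//
  mulrC.
apply: (@le_trans _ _ (((a * e) `^ a^-1) `^ a)).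
  rewrite ge0_ler_powR ?nnegrE ?powR_ge0 ?(ltW a0) ?(ltW eta0)//.
  by rewrite ge_min lexx orbT.
by rewrite -powRrM mulVf ?gt_eqF// powRr1// mulr_ge0// ltW.
Qed.

End power_integrals.

(** * Bounds on the partial Besov seminorms *)

Section besov_bounds.
Context {R : realType} {n : nat}.
Local Notation V := 'rV[R]_n.
Local Notation leb := (@lebesgue_measure R).
Variables (p q alpha : R).
Hypotheses (p1 : 1 <= p) (q1 : 1 <= q).
Implicit Types (u : V -> R) (k : 'I_n).

Let q0 : 0 < q. Proof. exact: lt_le_trans q1. Qed.

Lemma modulus_ge k u (t h : R) : 0 <= h <= t ->
  (norm_Lp p (fun x => u (x + h *: unit_vec k) - u x)%R <= modulus k u t p)%E.
Proof. by move=> ht; apply: ereal_sup_ubound; exists h. Qed.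

Lemma modulus_ge0 k u (t : R) : 0 <= t -> (0 <= modulus k u t p)%E.
Proof.
move=> t0; apply: le_trans (@modulus_ge k u t 0 _); first exact: norm_Lp_ge0.
by rewrite lexx.
Qed.

(** The modulus of continuity is at most [t ||D_k u||]. *)
Lemma modulus_le_lipschitz k u (t A : R) : test_fun u -> 0 <= t -> 0 <= A ->
  (norm_Lp p (partial k u) <= A%:E)%E -> (modulus k u t p <= (t * A)%:E)%E.
Proof.
move=> tu t0 A0 uA; apply: ge_ereal_sup => _ [h /= /andP[h0 ht] <-].
apply: le_trans (norm_Lp_diff_le p1 tu h0 A0 uA) _.
by rewrite lee_fin ler_wpM2r.
Qed.

Lemma modulus_le_norm k u (t M : R) : test_fun u ->
  (norm_Lp p u <= M%:E)%E -> (modulus k u t p <= (2 * M)%:E)%E.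
Proof.
move=> tu uM; apply: ge_ereal_sup => _ [h _ <-].
have mu_ := test_fun_measurable tu.
have mN : measurable_fun setT (fun x => - u x) by apply: measurableT_comp.
apply: le_trans (norm_LpD p1 (measurable_shift (h *: unit_vec k) mu_) mN) _.
rewrite norm_Lp_shift// (_ : 2 * M = M + M); last by rewrite mulr_natl mulr2n.
rewrite EFinD leeD//; apply: le_trans uM.
by rewrite norm_Lp_le// => x; rewrite normrN.
Qed.

Lemma powR_besov (t e C : R) : 0 < t -> 0 <= C ->
  (t `^ (- alpha) * (t `^ e * C)) `^ q * t^-1 = C `^ q * t `^
    ((e - alpha) * q - 1).
Proof.
move=> t0 C0; have tn : t != 0 by rewrite gt_eqF.
have tp s r : t `^ s * t `^ r = t `^ (s + r) by rewrite powRD// tn implybT.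
rewrite mulrA tp powRM ?powR_ge0// -powRrM -(powR_inv1 (ltW t0)).
by rewrite mulrAC tp mulrC (addrC (- alpha)).
Qed.

Lemma besov_integrand_le k u (t e C : R) : 0 < t -> 0 <= C ->
  (modulus k u t p <= (t `^ e * C)%:E)%E ->
  ((((t `^ (- alpha))%:E * modulus k u t p) `^ q * (t^-1)%:E) <=
    (C `^ q * t `^ ((e - alpha) * q - 1))%:E)%E.
Proof.
move=> t0 C0 mC; rewrite -powR_besov// EFinM lee_wpmul2r ?lee_fin ?invr_ge0
  ?(ltW t0)//.
have m0 := modulus_ge0 k u (ltW t0).
rewrite -[leRHS]poweR_EFin gt0_ler_poweR ?(ltW q0)//.
- by rewrite in_itv/= leey andbT mule_ge0// lee_fin powR_ge0.
- by rewrite in_itv/= leey andbT lee_fin !mulr_ge0// powR_ge0.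
- by rewrite EFinM lee_wpmul2l// lee_fin powR_ge0.
Qed.

Lemma besov_integrand_ge k u (t C : R) : 0 < t -> 0 <= C ->
  ((t * C)%:E <= modulus k u t p)%E ->
  ((C `^ q * t `^ ((1 - alpha) * q - 1))%:E <=
   (((t `^ (- alpha))%:E * modulus k u t p) `^ q * (t^-1)%:E))%E.
Proof.
move=> t0 C0 mC; rewrite -powR_besov// EFinM lee_wpmul2r ?lee_fin ?invr_ge0
  ?(ltW t0)//.
have m0 := modulus_ge0 k u (ltW t0).
rewrite -[leLHS]poweR_EFin gt0_ler_poweR ?(ltW q0)//.
- by rewrite in_itv/= leey andbT lee_fin !mulr_ge0// powR_ge0.
- by rewrite in_itv/= leey andbT mule_ge0// lee_fin powR_ge0.
- by rewrite EFinM lee_wpmul2l// ?lee_fin ?powR_ge0// powRr1// ltW.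
Qed.

Lemma besov_integrand_ge0 k u (t : R) : 0 < t ->
  (0 <= ((t `^ (- alpha))%:E * modulus k u t p) `^ q * (t^-1)%:E)%E.
Proof. by move=> t0; rewrite mule_ge0 ?poweR_ge0// lee_fin invr_ge0 ltW. Qed.

Let E k u := (\int[leb]_(t in `]0%R, +oo[)
      (((t `^ (- alpha))%:E * modulus k u t p) `^ q * (t^-1)%:E))%E.

Let E_ge0 k u : (0 <= E k u)%E.
Proof.
apply: integral_ge0 => t /=; rewrite in_itv/= andbT => t0.
exact: besov_integrand_ge0.
Qed.

Lemma integral_Zpow (C s : R) (D : set (measurableTypeR R)) : measurable D ->
  (\int[leb]_(t in D) (C `^ q * t `^ s)%:E =
   (C `^ q)%:E * \int[leb]_(t in D) (t `^ s)%:E)%E.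
Proof.
move=> mD; under eq_integral do rewrite EFinM.
rewrite ge0_integralZl//.
- exact: measurable_powR_EFin.
- by move=> x _; rewrite lee_fin powR_ge0.
- by rewrite lee_fin powR_ge0.
Qed.

(** The Besov integral is split at [t = 1]: the gradient controls the part
    [t <= 1] and the norm of [u] controls the part [t > 1]. *)
Lemma besov_partial_le k u (A M : R) : 0 < alpha < 1 -> test_fun u ->
  0 <= A -> 0 <= M ->
  (norm_Lp p (partial k u) <= A%:E)%E -> (norm_Lp p u <= M%:E)%E ->
  (besov_partial alpha p q k u <=
   ((A `^ q * ((1 - alpha) * q)^-1 + (2 * M) `^ q * (alpha * q)^-1) `^
     q^-1)%:E)%E.
Proof.
move=> /andP[a0 a1] tu A0 M0 uA uM.
have b0 : 0 < (1 - alpha) * q by rewrite mulr_gt0// subr_gt0.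
have d0 : 0 < alpha * q by rewrite mulr_gt0.
set B := _ + _.
have B0 : 0 <= B.
  by rewrite addr_ge0// mulr_ge0 ?powR_ge0// invr_ge0 ltW.
suff H : (E k u <= B%:E)%E.
  rewrite /besov_partial -poweR_EFin gt0_ler_poweR ?invr_ge0 ?(ltW q0)//.
  - by rewrite in_itv/= leey andbT E_ge0.
  - by rewrite in_itv/= leey andbT lee_fin.
pose f1 (t : measurableTypeR R) := (A `^ q * t `^ ((1 - alpha) * q - 1))%:E.
pose f2 (t : measurableTypeR R) := ((2 * M) `^ q * t `^ (- (alpha * q) - 1))%:E.
pose D1 : set (measurableTypeR R) := `]0%R, 1%R]%classic.
pose D2 : set (measurableTypeR R) := `]1%R, +oo[%classic.
pose D : set (measurableTypeR R) := `]0%R, +oo[%classic.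
have f10 t : (0 <= f1 t)%E by rewrite lee_fin mulr_ge0// powR_ge0.
have f20 t : (0 <= f2 t)%E by rewrite lee_fin mulr_ge0// powR_ge0.
have mf1 : measurable_fun setT f1.
  by apply/measurable_EFinP; apply: measurable_funM => //;
    exact: measurable_powR_fun.
have mf2 : measurable_fun setT f2.
  by apply/measurable_EFinP; apply: measurable_funM => //;
    exact: measurable_powR_fun.
have mD1 : measurable D1 by exact: measurable_itv.
have mD2 : measurable D2 by exact: measurable_itv.
have mD : measurable D by exact: measurable_itv.
apply: (@le_trans _ _ (\int[leb]_(t in D) ((f1 \_ D1) t + (f2 \_ D2) t))%E).
  apply: ge0_le_integral_pointwise => t /=; rewrite in_itv/= andbT => t0.
    exact: besov_integrand_ge0.
  rewrite !patchE; have [t1|t1] := leP t 1.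
    rewrite mem_set; last by rewrite /D1/= in_itv/= t0 t1.
    rewrite memNset ?adde0; last by rewrite /D2/= in_itv/= andbT; apply/negP;
      rewrite -leNgt.
    apply: besov_integrand_le => //; rewrite powRr1 ?(ltW t0)//.
    by apply: modulus_le_lipschitz => //; exact: ltW.
  rewrite memNset; last by rewrite /D1/= in_itv/= t0/=; apply/negP;
    rewrite -ltNge.
  rewrite mem_set ?add0e; last by rewrite /D2/= in_itv/= andbT.
  rewrite /f2 (_ : - (alpha * q) = (0 - alpha) * q);
    last by rewrite sub0r mulNr.
  apply: besov_integrand_le => //; first by rewrite mulr_ge0.
  by rewrite powRr0 mul1r; exact: modulus_le_norm.
have mr1 : measurable_fun setT (f1 \_ D1).
  by apply: (measurable_restrictT _ mD1).1; exact: measurable_funTS.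
have mr2 : measurable_fun setT (f2 \_ D2).
  by apply: (measurable_restrictT _ mD2).1; exact: measurable_funTS.
rewrite ge0_integralD//; last 4 first.
- by move=> t _; apply: erestrict_ge0.
- exact: measurable_funTS mr1.
- by move=> t _; apply: erestrict_ge0.
- exact: measurable_funTS mr2.
rewrite -!integral_mkcondr.
have -> : D `&` D1 = D1.
  by apply: setIidr => t; rewrite /D1 /D /= !in_itv/= => /andP[->].
have -> : D `&` D2 = D2.
  apply: setIidr => t; rewrite /D2 /D /= !in_itv/= !andbT; exact: lt_trans.
rewrite /B EFinD leeD//.
  rewrite integral_Zpow// EFinM lee_wpmul2l ?lee_fin ?powR_ge0//.
  exact: integral_powR_01_le.
rewrite integral_Zpow// EFinM lee_wpmul2l ?lee_fin ?powR_ge0//.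
exact: integral_powR_1y_le.
Qed.

(** If the increments of [u] in L^p were at least [h * c] for all [h <= delta],
    the part [t <= delta] of the Besov integral would already be too large. *)
Lemma besov_partial_small_diff k u (delta c : R) : 0 < alpha < 1 ->
  0 < delta -> 0 <= c ->
  (besov_partial alpha p q k u <
   (c * (delta `^ ((1 - alpha) * q) / ((1 - alpha) * q)) `^ q^-1)%:E)%E ->
  exists2 h : R, 0 < h <= delta &
    (norm_Lp p (fun x => u (x + h *: unit_vec k) - u x)%R < (h * c)%:E)%E.
Proof.
move=> /andP[a0 a1] d0 c0 Bc.
have b0 : 0 < (1 - alpha) * q by rewrite mulr_gt0// subr_gt0.
set a := (1 - alpha) * q in b0 Bc *.
apply: contrapT => nh.
have H h : 0 < h <= delta ->
    ((h * c)%:E <= norm_Lp p (fun x => u (x + h *: unit_vec k) - u x)%R)%E.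
  by move=> hd; rewrite leNgt; apply/negP => hc; apply: nh; exists h.
have X0 : 0 <= delta `^ a / a by rewrite divr_ge0 ?powR_ge0// ltW.
suff HE : ((c `^ q * (delta `^ a / a))%:E <= E k u)%E.
  move: Bc; apply/negP; rewrite -leNgt.
  have -> : c * (delta `^ a / a) `^ q^-1 = (c `^ q * (delta `^ a / a)) `^ q^-1.
    by rewrite [RHS]powRM ?powR_ge0// -powRrM mulfV ?gt_eqF// powRr1.
  rewrite /besov_partial -poweR_EFin gt0_ler_poweR ?invr_ge0 ?(ltW q0)//.
  - by rewrite in_itv/= leey andbT lee_fin mulr_ge0// powR_ge0.
  - by rewrite in_itv/= leey andbT E_ge0.
apply/lee_addgt0Pr => e e0.
have [eta /andP[eta0 etad] Heta] :=
  @integral_powR_0d_ge R a delta (e / (c `^ q + 1)) b0 d0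
  (divr_gt0 e0 (ltr_wpDl (powR_ge0 _ _) ltr01)).
have : ((c `^ q)%:E * (delta `^ a / a - e / (c `^ q + 1))%:E <= E k u)%E.
  apply: (@le_trans _ _ ((c `^ q)%:E * \int[leb]_(t in `[eta, delta])
    (t `^ (a - 1))%:E)%E).
    by rewrite lee_wpmul2l// lee_fin powR_ge0.
  rewrite -integral_Zpow; last exact: measurable_itv.
  rewrite integral_mkcond /E [leRHS]integral_mkcond.
  apply: ge0_le_integral_pointwise => t _; rewrite patchE; case: ifPn => //.
  - by move=> _; rewrite lee_fin mulr_ge0// powR_ge0.
  - move=> /set_mem; rewrite /= in_itv/= => /andP[t1 t2].
    have t0 : 0 < t by exact: lt_le_trans t1.
    rewrite patchE mem_set; last by rewrite /= in_itv/= t0.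
    apply: besov_integrand_ge => //.
    apply: le_trans (H t _) (@modulus_ge k u t t _); first by rewrite t0.
    by rewrite lexx ltW.
  - move=> _; rewrite patchE; case: ifPn => // /set_mem.
    rewrite /= in_itv/= andbT => t0; exact: besov_integrand_ge0.
rewrite -EFinM => HE; apply:
  (@le_trans _ _ ((c `^ q * (delta `^ a / a - e / (c `^ q + 1)))%:E + e%:E)%E).
  rewrite -EFinD lee_fin mulrBr -addrA lerDl addrC subr_ge0 mulrCA.
  rewrite ger_pMr// ler_pdivrMr ?mul1r ?lerDl//.
  by rewrite ltr_wpDl// powR_ge0.
by rewrite leeD2r.
Qed.

End besov_bounds.

(** * Construction of competitors *)

Section competitors.
Context {R : realType} {n : nat}.
Local Notation V := 'rV[R]_n.
Implicit Types (f g u : V -> R) (k : 'I_n).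

(** The competitor for the Besov capacity: a smooth truncation of [f], with an
    L^p norm bounded independently of [f]. *)
Lemma truncated_competitor (p c a : R) : 1 <= p -> p < n%:R -> 1 < c ->
  0 <= a ->
  exists2 M : R, 0 <= M & forall f, test_fun f ->
    (sobolev_seminorm p f <= a%:E)%E -> exists g,
    [/\ test_fun g, forall x, 1 <= f x -> 1 <= g x,
        forall k, (norm_Lp p (partial k g) <= c%:E * norm_Lp p (partial k f))%E
          &
        (norm_Lp p g <= M%:E)%E].
Proof.
move=> p1 pn c1 a0; have c0 : 0 < c by exact: lt_trans c1.
have [eps e0 [Phi [dPhi Phi1 Phi0 Phige]]] := smooth_cutoff c1.
have [M M0 HM] := truncation_Lp_bound p1 pn e0 a0.
exists (c * M); first by rewrite mulr_ge0// ltW.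
move=> f tf fa; have [sf cf] := tf.
have tg : test_fun (Phi 0%N \o f).
  split; first exact: smooth_comp.
  apply: (compactly_supportedP cf) => x nx /=.
  have -> : f x = 0.
    by apply: contrapT => /eqP fx; apply: nx; apply: subset_closure.
  apply/eqP; rewrite -normr_le0; apply: (le_trans (Phi0 0)).
  by rewrite max_l ?mulr0// sub0r oppr_le0 ltW.
have mf := test_fun_measurable tf.
exists (Phi 0%N \o f); split => //.
- by move=> x fx; exact: Phige.
- move=> k; rewrite -[X in (X%:E * _)%E](gtr0_norm c0).
  rewrite -norm_LpZ//; last exact: test_fun_measurable (test_fun_partial k tf).
  apply: norm_Lp_le => // x.
  have [_ D] := is_derive_comp_scalar (dPhi 0%N)
    (@test_fun_derivable R n f k x tf).
  have -> : partial k (Phi 0%N \o f) x = Phi 1%N (f x) * partial k f x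
    by exact: D.
  by rewrite !normrM (gtr0_norm c0) ler_wpM2r.
- have mt : measurable_fun setT (fun x => Num.max 0 (f x - eps)).
    by apply: measurable_maxr => //; apply: measurable_funB.
  rewrite EFinM; apply: (@le_trans _ _
    (c%:E * norm_Lp p (fun x => Num.max 0 (f x - eps))%R)%E).
    rewrite -[X in (X%:E * _)%E](gtr0_norm c0) -norm_LpZ//;
      apply: norm_Lp_le => // x /=.
    apply: le_trans (Phi0 _) _; exact: ler_norm.
  by rewrite lee_wpmul2l ?lee_fin ?(ltW c0)//; exact: HM.
Qed.

(** Steklov averages of steps [h k] along the axes [k] listed in [s]. *)
Definition iter_steklov (h : 'I_n -> R) (s : seq 'I_n) u : V -> R :=
  foldr (fun k w => steklov (h k *: unit_vec k) w) u s.

Lemma test_fun_iter_steklov h s u : test_fun u -> test_fun (iter_steklov h s u).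
Proof. by move=> tu; elim: s => [//|k s IH]; exact: test_fun_steklov. Qed.

Lemma iter_steklov_diff p h s u (w : V) (C : R) : 1 <= p -> test_fun u ->
  0 <= C ->
  (norm_Lp p (fun x => u (x + w) - u x)%R <= C%:E)%E ->
  (norm_Lp p (fun x => iter_steklov h s u (x + w) - iter_steklov h s u x)%R
    <= C%:E)%E.
Proof.
move=> p1 tu C0 uC; elim: s => [//|k s IH] /=.
have ct := test_fun_continuous (test_fun_iter_steklov h s tu).
under [X in norm_Lp p X]eq_fun do rewrite steklov_diff//.
apply: norm_Lp_steklov => //.
move=> x; apply: (@continuousB R R V (fun y => iter_steklov h s u (y + w))
  (iter_steklov h s u) x).
  apply: (@continuous_comp _ _ _ (fun y : V => y + w) (iter_steklov h s u) x).
    exact: continuous_addV.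
  exact: ct.
exact: ct.
Qed.

(** All the averages but the one in the direction [k] commute with the
    increments along [k] and are contractions of L^p. *)
Lemma iter_steklov_partial p h s u k (c : R) : 1 <= p -> test_fun u ->
  0 < h k -> 0 <= c ->
  (norm_Lp p (fun x => u (x + h k *: unit_vec k) - u x)%R <= (h k * c)%:E)%E ->
  k \in s -> (norm_Lp p (partial k (iter_steklov h s u)) <= c%:E)%E.
Proof.
move=> p1 tu hk c0 uc; elim: s => [//|j s IH]; rewrite in_cons /=.
have ts := test_fun_iter_steklov h s tu.
have tp := test_fun_partial k ts.
rewrite partial_steklov//.
have [<- _|kj /= ks] := eqVneq k j; last first.
  by apply: norm_Lp_steklov => //; [exact: test_fun_continuous|exact: IH].
have -> : steklov (h k *: unit_vec k) (partial k (iter_steklov h s u)) =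
   (fun x => (h k)^-1 * (iter_steklov h s u (x + h k *: unit_vec k)
     - iter_steklov h s u x)).
  by apply/funext => x; rewrite -steklov_FTC// mulKf// gt_eqF.
have mS := test_fun_measurable ts.
rewrite norm_LpZ//; last by apply: measurable_funB => //;
  exact: measurable_shift.
rewrite gtr0_norm ?invr_gt0// lee_pdivrMl//.
apply: iter_steklov_diff => //; by rewrite mulr_ge0// ltW.
Qed.

Lemma iter_steklov_ge1 (delta : R) h s u x : test_fun u ->
  (forall k, 0 < h k <= delta) -> uniq s ->
  (forall y : V, (forall i, 0 <= y ord0 i <= delta) ->
     (forall i, i \notin s -> y ord0 i = 0) -> 1 <= u (x + y)) ->
  1 <= iter_steklov h s u x.
Proof.
move=> tu hd; elim: s x => [|k s IH] x.
  move=> _ /(_ 0); rewrite addr0; apply.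
    move=> i; rewrite mxE lexx/=.
    by have /andP[/ltW h0 h1] := hd i; exact: le_trans h1.
  by move=> i _; rewrite mxE.
move=> /= /andP[ks us] H; apply: steklov_ge1.
  exact: test_fun_continuous (test_fun_iter_steklov h s tu).
move=> t /andP[t0 t1]; apply: IH => // y yd ys.
have /andP[hk0 hk1] := hd k.
rewrite -addrA; apply: H => i; rewrite !mxE eqxx /=.
  have [->|ik] := eqVneq i k.
    rewrite mulr1 (ys k ks) addr0 mulr_ge0 ?(ltW hk0)//=.
    by apply: le_trans hk1; rewrite ler_piMl// ltW.
  by rewrite !mulr0 add0r.
rewrite in_cons negb_or => /andP[/negPf -> is_].
by rewrite !mulr0 add0r ys.
Qed.

(** The set [K + [0, delta]^n]. *)
Definition cube_nbhd (K : set V) (delta : R) : set V :=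
  (fun z : V * V => z.1 + z.2) @` (K `*` cube delta).

Lemma compact_cube (delta : R) : compact (cube delta : set V).
Proof.
apply: (@rV_compact R n (fun=> `[0, delta]%classic)) => i.
exact: segment_compact.
Qed.

Lemma compact_cube_nbhd (K : set V) (delta : R) : compact K ->
  compact (cube_nbhd K delta).
Proof.
move=> cK; apply: continuous_compact; last first.
  by apply: compact_setX => //; exact: compact_cube.
apply: continuous_subspaceT => z.
by apply: (@continuousD _ V (V * V)%type fst snd z);
  [exact: cvg_fst|exact: cvg_snd].
Qed.

(** By compactness, a small cube can be added to [K] inside [G]. *)
Lemma cube_nbhd_sub_open (K G : set V) : compact K -> open G -> K `<=` G ->
  exists2 delta : R, 0 < delta & cube_nbhd K delta `<=` G.
Proof.
move=> /compact_near_coveringP cK oG KG.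
have [d [dG d0]] : exists d : R,
    (K `<=` (fun x => forall y, cube d y -> G (x + y))) /\ 0 < d.
  apply: filter_ex (filterI _ (nbhs_right_gt (0 : R))).
  apply: (cK R (0 : R)^'+ (fun d x => forall y, cube d y -> G (x + y)) _) =>
    x Kx.
  have /nbhs_ballP[e /= e0 He] : nbhs x G.
    by apply: open_nbhs_nbhs; split => //; exact: KG.
  have e2 : 0 < e / 2 by rewrite divr_gt0.
  exists (ball x (e / 2), [set d | d < e / 2]).
    by split; [exact: nbhsx_ballx|exact: nbhs_right_lt].
  move=> [x' d] /= [xx' de] y dy; apply: He.
  rewrite -ball_normE /= in xx' *.
  rewrite opprD addrA (le_lt_trans (ler_normB _ _))// (splitr e) ltr_leD//.
  apply: norm_le_coord; first exact: ltW.
  move=> i; have := dy i; rewrite in_itv/= => /andP[y0 yd].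
  by rewrite ger0_norm// (le_trans yd)// ltW.
exists d => // _ [[x y] /= [Kx dy] <-]; exact: dG.
Qed.

End competitors.

(** * Comparison of the two capacities *)

Section capacity_estimates.
Context {R : realType} {n : nat}.
Local Notation V := 'rV[R]_n.
Variables (p q : R).
Hypotheses (p1 : 1 <= p) (q1 : 1 <= q).
Implicit Types (f g u : V -> R) (k : 'I_n) (K G : set V).

Let p0 : 0 < p. Proof. exact: lt_le_trans p1. Qed.
Let q0 : 0 < q. Proof. exact: lt_le_trans q1. Qed.

Lemma besov_partial_ge0 alpha k u : (0 <= besov_partial alpha p q k u)%E.
Proof. exact: poweR_ge0. Qed.

Lemma besov_seminorm_ge0 alpha u : (0 <= besov_seminorm alpha p q u)%E.
Proof. by apply: sume_ge0 => k _; exact: besov_partial_ge0. Qed.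

Lemma sobolev_seminorm_ge0 u : (0 <= sobolev_seminorm p u)%E.
Proof. by apply: sume_ge0 => k _; exact: norm_Lp_ge0. Qed.

Lemma cap_compact_ge0 (N : (V -> R) -> \bar R) K : (0 <= cap_compact p N K)%E.
Proof. by apply: le_ereal_inf_tmp => _ [f _ <-]; exact: poweR_ge0. Qed.

Lemma cap_open_ge0 (N : (V -> R) -> \bar R) G : (0 <= cap_open p N G)%E.
Proof.
apply: le_trans (cap_compact_ge0 N set0) _.
by apply: ereal_sup_ubound; exists set0 => //; split => //; exact: compact0.
Qed.

Lemma cap_compact_le_open (N : (V -> R) -> \bar R) K G : compact K ->
  K `<=` G ->
  (cap_compact p N K <= cap_open p N G)%E.
Proof. by move=> cK KG; apply: ereal_sup_ubound; exists K. Qed.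

(** One admissible function for the Besov capacity of the enlarged compact set
    bounds the Sobolev capacity of [K]. *)
Lemma capW_compact_le_besov alpha (delta B : R) K f : 0 < alpha < 1 ->
  0 < delta ->
  admissible (cube_nbhd K delta) f -> besov_seminorm alpha p q f = B%:E ->
  (cap_compact p (sobolev_seminorm p) K <=
   ((((delta `^ ((1 - alpha) * q) / ((1 - alpha) * q)) `^ q^-1)^-1 * B) `^
     p)%:E)%E.
Proof.
move=> al01 d0 [sf cf f1] fB; set a := (1 - alpha) * q.
have /andP[a0 a1] := al01.
have aa0 : 0 < a by rewrite mulr_gt0// subr_gt0.
have X0 : 0 < delta `^ a / a by rewrite divr_gt0// powR_gt0.
set kap := ((delta `^ a / a) `^ q^-1)^-1.
have k0 : 0 < kap by rewrite invr_gt0 powR_gt0.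
have tf : test_fun f by split.
pose b k := fine (besov_partial alpha p q k f).
have bE k : besov_partial alpha p q k f = (b k)%:E.
  rewrite /b fineK// ge0_fin_numE ?besov_partial_ge0//.
  apply: (@le_lt_trans _ _ (besov_seminorm alpha p q f));
    last by rewrite fB ltry.
  rewrite /besov_seminorm (bigD1 k)//= leeDl//.
  by apply: sume_ge0 => j _; exact: besov_partial_ge0.
have b0 k : 0 <= b k by rewrite -lee_fin -bE besov_partial_ge0.
have BE : B = \sum_k b k.
  by apply: EFin_inj; rewrite -fB -sumEFin; apply: eq_bigr => k _.
have B0 : 0 <= B by rewrite BE sumr_ge0.
have H (eta : R) : 0 < eta -> (cap_compact p (sobolev_seminorm p) K <=
    ((kap * (B + n%:R * eta)) `^ p)%:E)%E.
  move=> eta0.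
  have Hk k : exists h : R, 0 < h <= delta /\
     (norm_Lp p (fun x => f (x + h *: unit_vec k) - f x)%R <
       (h * (kap * (b k + eta)))%:E)%E.
    (* The slack [eta] makes the hypothesis of the lemma a strict inequality. *)
    have [||h h1 h2] := @besov_partial_small_diff R n p q alpha q1 k f delta
      (kap * (b k + eta)) al01 d0.
    - by rewrite mulr_ge0 ?addr_ge0 ?(ltW k0)// ltW.
    - rewrite bE lte_fin -/a mulrAC mulVf ?mul1r ?ltrDl//.
      by rewrite gt_eqF// powR_gt0.
    - by exists h.
  have [h Hh] := choice Hk.
  pose g := iter_steklov h (enum 'I_n) f.
  have tg : test_fun g by exact: test_fun_iter_steklov.
  have admg : admissible K g.
    case: tg => sg cg; split => // x Kx.
    apply: (@iter_steklov_ge1 _ _ delta) => //.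
    - by move=> k; case: (Hh k).
    - exact: enum_uniq.
    - move=> y yd _; apply: f1; by exists (x, y).
  apply: (@le_trans _ _ (sobolev_seminorm p g `^ p)%E).
    by apply: ereal_inf_lbound; exists g.
  rewrite -poweR_EFin gt0_ler_poweR ?(ltW p0)//.
  - by rewrite in_itv/= leey sobolev_seminorm_ge0.
  - rewrite in_itv/= leey lee_fin mulr_ge0 ?(ltW k0)// addr_ge0// mulr_ge0//
      ltW//.
  have -> : kap * (B + n%:R * eta) = \sum_k kap * (b k + eta).
    by rewrite -mulr_sumr big_split/= -BE sumr_const card_ord mulr_natl.
  rewrite -sumEFin; apply: lee_sum => k _.
  have [/andP[h0 _] hn] := Hh k.
  apply: (iter_steklov_partial p1 tf h0 _ (ltW hn)); last by rewrite mem_enum.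
  by rewrite mulr_ge0 ?addr_ge0 ?(ltW k0)// ltW.
have Y0 := cap_compact_ge0 (sobolev_seminorm p) K.
case E : (cap_compact p (sobolev_seminorm p) K) => [y| |];
  last by rewrite leNye.
  rewrite E lee_fin in Y0.
  rewrite lee_fin.
  suff Hy : y `^ p^-1 <= kap * B.
    have -> : y = (y `^ p^-1) `^ p by rewrite -powRrM mulVf ?gt_eqF// powRr1.
    by rewrite ge0_ler_powR ?nnegrE ?powR_ge0 ?(ltW p0)// mulr_ge0// ltW.
  apply/ler_addgt0Pr => e e0.
  have d1 : 0 < kap * (n%:R + 1) by rewrite mulr_gt0// ltr_wpDl.
  have := H (e / (kap * (n%:R + 1))) (divr_gt0 e0 d1).
  rewrite E lee_fin => Hy.
  apply: (@le_trans _ _ (kap * (B + n%:R * (e / (kap * (n%:R + 1)))))).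
    move: Hy; set Z := kap * _ => Hy.
    have Z0 : 0 <= Z.
      by rewrite mulr_ge0 ?(ltW k0)// addr_ge0// mulr_ge0// divr_ge0 ?(ltW d1)
        ?(ltW e0).
    have -> : Z = (Z `^ p) `^ p^-1 by rewrite -powRrM mulfV ?gt_eqF// powRr1.
    by rewrite ge0_ler_powR ?nnegrE ?powR_ge0// invr_ge0 ltW.
  rewrite mulrDr lerD2l.
  have -> : kap * (n%:R * (e / (kap * (n%:R + 1)))) = e * (n%:R / (n%:R + 1)).
    by field; rewrite gt_eqF//= gt_eqF// ltr_wpDl.
  rewrite ler_piMr ?(ltW e0)// ler_pdivrMr ?ltr_wpDl// mul1r lerDl//.
have := H 1 ltr01; rewrite E leye_eq => /eqP //.
Qed.

(** The lower estimate: as [alpha] tends to 1, the power of [delta] tends to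
    1. *)
Lemma capW_compact_le_capB alpha (delta : R) K G : 0 < alpha < 1 -> 0 < delta ->
  compact K -> cube_nbhd K delta `<=` G ->
  (((delta `^ ((1 - alpha) * p) * (q^-1) `^ (p / q))%:E *
     cap_compact p (sobolev_seminorm p) K) <=
   ((1 - alpha) `^ (p / q))%:E * capB alpha p q G)%E.
Proof.
move=> al01 d0 cK KG; have /andP[a0 a1] := al01.
have b0 : 0 < 1 - alpha by rewrite subr_gt0.
pose a := (1 - alpha) * q.
have aa0 : 0 < a by rewrite mulr_gt0.
pose kap := ((delta `^ a / a) `^ q^-1)^-1.
have k0 : 0 < kap by rewrite invr_gt0 powR_gt0// divr_gt0// powR_gt0.
pose cN := cap_compact p (besov_seminorm alpha p q) (cube_nbhd K delta).
have H1 : (cap_compact p (sobolev_seminorm p) K <= (kap `^ p)%:E * cN)%E.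
  rewrite -lee_pdivrMl ?powR_gt0//; apply: le_ereal_inf_tmp => _ [f af <-].
  rewrite lee_pdivrMl ?powR_gt0//.
  have := besov_seminorm_ge0 alpha f.
  case E : (besov_seminorm alpha p q f) => [B| |]// B0; last first.
    by rewrite poweRyr ?gt_eqF// gt0_muley ?leey// lte_fin powR_gt0.
  rewrite poweR_EFin -EFinM -powRM ?(ltW k0)//.
  exact: (capW_compact_le_besov al01 d0 af E).
have H2 : (cN <= capB alpha p q G)%E.
  by apply: cap_compact_le_open => //; exact: compact_cube_nbhd.
have kE : (delta `^ ((1 - alpha) * p) * (q^-1) `^ (p / q)) * kap `^ p
  = (1 - alpha) `^ (p / q).
  have pqE : p / q = q^-1 * p by rewrite mulrC.
  pose X := delta `^ (1 - alpha) * (q^-1) `^ q^-1.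
  pose Y := (1 - alpha) `^ q^-1.
  have X0 : 0 < X by rewrite mulr_gt0 ?powR_gt0 ?invr_gt0.
  have Y0 : 0 < Y by rewrite powR_gt0.
  have kinv : (delta `^ a / a) `^ q^-1 = X / Y.
    rewrite powRM ?invr_ge0 ?powR_ge0 ?(ltW aa0)// -powRrM /a.
    rewrite mulfK ?gt_eqF// invfM powRM ?invr_ge0 ?(ltW b0) ?(ltW q0)//.
    rewrite -(powR_inv1 (ltW b0)) -powRrM mulN1r powRN /X /Y.
    by rewrite -mulrA [X in _ * X]mulrC.
  have -> : kap = Y / X by rewrite /kap kinv invf_div.
  rewrite pqE !powRrM -powRM ?powR_ge0// -powRM ?divr_ge0 ?(ltW X0) ?(ltW Y0)//.
  by rewrite -/X mulrCA divff ?mulr1// gt_eqF.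
apply: (@le_trans _ _ ((delta `^ ((1 - alpha) * p) * (q^-1) `^ (p / q))%:E *
   ((kap `^ p)%:E * capB alpha p q G))%E).
  rewrite lee_wpmul2l ?lee_fin ?mulr_ge0 ?powR_ge0//.
  apply: le_trans H1 _; rewrite lee_wpmul2l ?lee_fin ?powR_ge0//.
by rewrite muleA -EFinM kE.
Qed.

Lemma powRD_ge (x y : R) : 0 <= x -> 0 <= y -> x `^ q + y `^ q <= (x + y) `^ q.
Proof.
move=> x0 y0; rewrite -(mulr_powRB1 x0 q0) -(mulr_powRB1 y0 q0).
rewrite -(mulr_powRB1 (addr_ge0 x0 y0) q0) mulrDl.
have q10 : 0 <= q - 1 by rewrite subr_ge0.
by apply: lerD; rewrite ler_wpM2l// ge0_ler_powR ?nnegrE ?(addr_ge0 x0 y0)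
  ?lerDl ?lerDr.
Qed.

(** [besov_partial_le] combined with the subadditivity of the power [1 / q]. *)
Lemma besov_partial_le_sum alpha k u (A M : R) : 0 < alpha < 1 -> test_fun u ->
  0 <= A -> 0 <= M ->
  (norm_Lp p (partial k u) <= A%:E)%E -> (norm_Lp p u <= M%:E)%E ->
  (besov_partial alpha p q k u <=
   (((1 - alpha) * q) `^ (- q^-1) * A + (alpha * q) `^ (- q^-1)
     * (2 * M))%:E)%E.
Proof.
move=> al01 tu A0 M0 uA uM; have /andP[a0 a1] := al01.
apply: (le_trans (besov_partial_le p1 q1 al01 tu A0 M0 uA uM)).
have b0 : 0 < (1 - alpha) * q by rewrite mulr_gt0// subr_gt0.
have d0 : 0 < alpha * q by rewrite mulr_gt0.
have E (x y : R) : 0 < x -> 0 <= y -> y `^ q * x^-1 = (x `^ (- q^-1) * y) `^ q.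
  move=> x0 y0; rewrite powRM ?powR_ge0// -powRrM mulNr mulVf ?gt_eqF// mulrC.
  by rewrite powR_inv1// ltW.
rewrite lee_fin !E ?mulr_ge0//.
set x := _ * A; set y := _ * (2 * M).
have x0 : 0 <= x by rewrite mulr_ge0 ?powR_ge0.
have y0 : 0 <= y by rewrite !mulr_ge0 ?powR_ge0.
have -> : x + y = ((x + y) `^ q) `^ q^-1.
  by rewrite -powRrM mulfV ?gt_eqF// powRr1// addr_ge0.
by rewrite ge0_ler_powR ?nnegrE ?addr_ge0 ?powR_ge0 ?invr_ge0 ?(ltW q0)//
  powRD_ge.
Qed.

(** The upper estimate: as [alpha] tends to 1, the second summand vanishes.  The
    constant [D] does not depend on the compact subsets of [G]. *)
Lemma capB_upper_bound (c a : R) G : p < n%:R -> 1 < c -> 0 < a ->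
  (capW p G < (a `^ p)%:E)%E ->
  exists2 D : R, 0 <= D & forall alpha, 0 < alpha < 1 ->
   (((1 - alpha) `^ (p / q))%:E * capB alpha p q G <=
    ((q `^ (- q^-1) * (c * a) + (alpha * q) `^ (- q^-1) * D * (1 - alpha) `^
      q^-1) `^ p)%:E)%E.
Proof.
move=> pn c1 a0 Ga; have c0 : 0 < c by exact: lt_trans c1.
have [M M0 HM] := truncated_competitor p1 pn c1 (ltW a0).
exists (n%:R * (2 * M)); first by rewrite !mulr_ge0.
move=> alpha al01; have /andP[al0 al1] := al01.
have b0 : 0 < 1 - alpha by rewrite subr_gt0.
set Z := q `^ _ * _ + _.
have D0 : 0 <= n%:R * (2 * M) by rewrite !mulr_ge0.
have Z0 : 0 <= Z.
  apply: addr_ge0.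
    by apply: mulr_ge0; [exact: powR_ge0|exact: (mulr_ge0 (ltW c0) (ltW a0))].
  apply: mulr_ge0; last exact: powR_ge0.
  by apply: mulr_ge0; [exact: powR_ge0|exact: D0].
rewrite -lee_pdivlMl ?powR_gt0//.
apply: ge_ereal_sup => _ [K [cK KG] <-].
have : (cap_compact p (sobolev_seminorm p) K < (a `^ p)%:E)%E.
  by apply: le_lt_trans Ga; exact: cap_compact_le_open.
move=> /ereal_inf_lt[_ [f [sf cf f1] <-]] fa.
have tf : test_fun f by [].
have {}fa : (sobolev_seminorm p f <= a%:E)%E.
  rewrite leNgt; apply/negP => af; move: fa; apply/negP; rewrite -leNgt.
  rewrite -poweR_EFin gt0_ler_poweR ?(ltW p0)//.
  - by rewrite in_itv/= leey lee_fin ltW.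
  - by rewrite in_itv/= leey sobolev_seminorm_ge0.
  - exact: ltW.
have [g [tg g1 gk gM]] := HM f tf fa.
have ag : admissible K g by case: tg => sg cg; split => // x /f1 /g1.
apply: (@le_trans _ _ (besov_seminorm alpha p q g `^ p)%E).
  by apply: ereal_inf_lbound; exists g.
pose A k := fine (norm_Lp p (partial k f)).
have AE k : norm_Lp p (partial k f) = (A k)%:E.
  rewrite /A fineK// ge0_fin_numE ?norm_Lp_ge0//.
  exact: (norm_Lp_test_fin p1 (test_fun_partial k tf)).
have A0 k : 0 <= A k by rewrite -lee_fin -AE norm_Lp_ge0.
have Aa : \sum_k A k <= a.
  by move: fa; rewrite /sobolev_seminorm (eq_bigr (fun k => (A k)%:E))//
    sumEFin lee_fin.
have Hb : (besov_seminorm alpha p q g <= ((1 - alpha) `^ (- q^-1) * Z)%:E)%E.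
  apply: (@le_trans _ _ (\sum_(k < n)
    (((1 - alpha) * q) `^ (- q^-1) * (c * A k) + (alpha * q) `^ (- q^-1)
    * (2 * M))%:E)%E).
    apply: lee_sum => k _; apply: besov_partial_le_sum => //.
      by rewrite mulr_ge0// ltW.
    by have := gk k; rewrite AE -EFinM.
  rewrite sumEFin lee_fin big_split/= sumr_const card_ord -!mulr_sumr.
  rewrite /Z mulrDr lerD//.
    rewrite powRM ?(ltW b0) ?(ltW q0)// -mulrA ler_wpM2l ?powR_ge0//.
    by rewrite ler_wpM2l ?powR_ge0// ler_wpM2l// ltW.
  have un : (1 - alpha) `^ q^-1 != 0 by rewrite gt_eqF// powR_gt0.
  rewrite [(1 - alpha) `^ (- _)]powRN [leRHS]mulrCA mulVf// mulr1.
  by rewrite -[leLHS]mulr_natl [leLHS]mulrCA.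
apply: (@le_trans _ _ (((1 - alpha) `^ (- q^-1) * Z)%:E `^ p)%E).
  apply: gt0_ler_poweR => //; first exact: ltW.
  - by rewrite in_itv/= leey besov_seminorm_ge0.
  - by rewrite in_itv/= leey lee_fin mulr_ge0 ?powR_ge0.
rewrite poweR_EFin powRM ?powR_ge0// -powRrM EFinM.
by rewrite -powRN (_ : - q^-1 * p = - (p / q))// mulNr mulrC.
Qed.

End capacity_estimates.

(** * The limit *)

Section limits.
Context {R : realType}.

Lemma near_left1_powR (delta p t : R) : 0 < delta -> t < 1 ->
  \forall alpha \near 1^'-, t < delta `^ ((1 - alpha) * p).
Proof.
move=> d0 t1.
have cf : continuous (fun alpha : R => expR ((1 - alpha) * p * ln delta)).
  move=> x; apply: continuous_comp; last exact: continuous_expR.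
  apply: cvgM; last exact: cvg_cst.
  apply: cvgM; last exact: cvg_cst.
  by apply: cvgB; [exact: cvg_cst|exact: cvg_id].
have : expR ((1 - alpha) * p * ln delta) @[alpha --> 1^'-] --> (1 : R).
  rewrite -[X in _ --> X]expR0 -(mul0r (ln delta)) -(mul0r p) -(subrr 1).
  by apply: cvg_at_left_filter; exact: cf.
move=> /(cvgr_gt _)/(_ t t1); apply: filterS => alpha.
by rewrite /powR gt_eqF.
Qed.

Lemma near_left1_powR_small (q e : R) : 0 < q -> 0 < e ->
  \forall alpha \near 1^'-, (1 - alpha) `^ q^-1 < e.
Proof.
move=> q0 e0; near=> alpha.
have a1 : alpha < 1 by near: alpha; exact: nbhs_left_lt.
have ae : 1 - e `^ q < alpha.
  by near: alpha; apply: nbhs_left_gt; rewrite ltrBlDr ltrDl powR_gt0.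
have -> : e = (e `^ q) `^ q^-1.
  by rewrite -powRrM mulfV ?gt_eqF// powRr1// ltW.
rewrite gt0_ltr_powR ?invr_gt0// ?nnegrE ?powR_ge0 ?subr_ge0 ?(ltW a1)//.
by rewrite ltrBlDr addrC -ltrBlDr.
Unshelve. all: by end_near. Qed.

Lemma near_left1_itv (s : R) : s < 1 -> \forall alpha \near 1^'-, s < alpha < 1.
Proof.
move=> s1; near=> alpha; apply/andP; split; near: alpha.
  exact: nbhs_left_gt.
exact: nbhs_left_lt.
Unshelve. all: by end_near. Qed.

End limits.

Section asymptotics.
Context {R : realType} {n : nat}.
Local Notation V := 'rV[R]_n.
Variables (p q : R) (G : set V).
Hypotheses (p1 : 1 <= p) (q1 : 1 <= q).

Let p0 : 0 < p. Proof. exact: lt_le_trans p1. Qed.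
Let q0 : 0 < q. Proof. exact: lt_le_trans q1. Qed.

Lemma capB_eventually_gt (r : R) : open G ->
  (r%:E < (q^-1 `^ (p / q))%:E * capW p G)%E ->
  \forall alpha \near 1^'-,
    (r%:E < ((1 - alpha) `^ (p / q))%:E * capB alpha p q G)%E.
Proof.
move=> oG rG; set Q := q^-1 `^ (p / q) in rG *.
have Q0 : 0 < Q by rewrite powR_gt0// invr_gt0.
have [r0|r0] := ltP r 0.
  apply: nearW => alpha; apply: (@lt_le_trans _ _ 0%E);
    first by rewrite lte_fin.
  by rewrite mule_ge0 ?lee_fin ?powR_ge0// cap_open_ge0.
move: rG; rewrite -lte_pdivrMl// -EFinM => /ereal_sup_gt[_ [K [cK KG] <-]].
set s := Q^-1 * r => sK.
have s0 : 0 <= s by rewrite mulr_ge0// invr_ge0 ltW.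
(* A real number above [s], since the capacity of [K] may be infinite. *)
have [s' ss' s'K] : exists2 s',
  s < s' & (s'%:E <= cap_compact p (sobolev_seminorm p) K)%E.
  move: sK; case: (cap_compact p (sobolev_seminorm p) K) => [y| |]//.
    by rewrite lte_fin => sy; exists y.
  by move=> _; exists (s + 1); rewrite ?ltrDl ?leey.
have s'0 : 0 < s' by exact: le_lt_trans ss'.
have [delta d0 dG] := cube_nbhd_sub_open cK oG KG.
have ss1 : s / s' < 1 by rewrite ltr_pdivrMr// mul1r.
near=> alpha.
have al01 : 0 < alpha < 1 by near: alpha; exact: near_left1_itv.
apply: lt_le_trans (capW_compact_le_capB p1 q1 al01 d0 cK dG).
apply: (@lt_le_trans _ _ ((delta `^ ((1 - alpha) * p) * Q)%:E * s'%:E)%E);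
  last first.
  by rewrite lee_wpmul2l// lee_fin mulr_ge0 ?powR_ge0.
have dss : s / s' < delta `^ ((1 - alpha) * p).
  by near: alpha; exact: near_left1_powR.
rewrite -EFinM lte_fin.
have -> : r = s * Q by rewrite /s mulrC mulrA divff ?mul1r// gt_eqF.
by rewrite [ltRHS]mulrAC ltr_pM2r// -ltr_pdivrMr.
Unshelve. all: by end_near. Qed.

Lemma capB_eventually_le (w e : R) : p < n%:R -> capW p G = w%:E -> 0 < e ->
  \forall alpha \near 1^'-,
    (((1 - alpha) `^ (p / q))%:E * capB alpha p q G <=
     (q^-1 `^ (p / q) * w + e)%:E)%E.
Proof.
move=> pn Gw e0.
have w0 : 0 <= w by rewrite -lee_fin -Gw cap_open_ge0.
pose z := w `^ p^-1; pose Q := q `^ (- q^-1).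
have z0 : 0 <= z by exact: powR_ge0.
have Q0 : 0 < Q by exact: powR_gt0.
have zw : z `^ p = w by rewrite -powRrM mulVf ?gt_eqF// powRr1.
have Qp : Q `^ p = q^-1 `^ (p / q).
  by rewrite -powRrM -(powR_inv1 (ltW q0)) -powRrM mulN1r mulNr mulrC.
pose y := (q^-1 `^ (p / q) * w + e) `^ p^-1.
have l0 : 0 < q^-1 `^ (p / q) * w + e by rewrite ltr_wpDl// mulr_ge0// powR_ge0.
have y0 : 0 < y by exact: powR_gt0.
have yp : y `^ p = q^-1 `^ (p / q) * w + e.
  by rewrite -powRrM mulVf ?gt_eqF// powRr1// ltW.
have zQy : z * Q < y.
  rewrite ltNge; apply/negP => yz.
  have : y `^ p <= (z * Q) `^ p.
    by rewrite ge0_ler_powR ?nnegrE ?(ltW p0) ?(ltW y0)// mulr_ge0// ltW.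
  by rewrite yp powRM ?(ltW Q0)// zw Qp mulrC leNgt ltrDl e0.
(* The parameters [a > z] and [c > 1] are chosen with [c * a * Q < y]. *)
pose a := (z + y / Q) / 2.
have za : z < a by rewrite /a ltr_pdivlMr// mulr_natr mulr2n ltrD2l ltr_pdivlMr.
have a0 : 0 < a by exact: le_lt_trans za.
have ay : a * Q < y.
  rewrite -ltr_pdivlMr// /a ltr_pdivrMr// mulr_natr mulr2n ltrD2r.
  by rewrite ltr_pdivlMr.
have aQ0 : 0 < a * Q by rewrite mulr_gt0.
pose c := (1 + y / (a * Q)) / 2.
have yaQ : 1 < y / (a * Q) by rewrite ltr_pdivlMr// mul1r.
have c1 : 1 < c by rewrite /c midf_lt.
have cy : c * (a * Q) < y.
  by rewrite -ltr_pdivlMr// /c midf_lt.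
have Ga : (capW p G < (a `^ p)%:E)%E.
  by rewrite Gw lte_fin -zw gt0_ltr_powR// nnegrE// ltW.
have [D D0 HD] := capB_upper_bound p1 q1 pn c1 a0 Ga.
pose D' := (2^-1 * q) `^ (- q^-1) * D + 1.
have D'0 : 0 < D' by rewrite ltr_wpDl// mulr_ge0// powR_ge0.
near=> alpha.
have al : 2^-1 < alpha < 1.
  by near: alpha; apply: near_left1_itv; rewrite invf_lt1// ltr1n.
have /andP[al0 al1] := al.
have al00 : 0 < alpha by apply: lt_trans al0.
apply: le_trans (HD _ _) _; first by rewrite al00.
have sm : (1 - alpha) `^ q^-1 < (y - c * (a * Q)) / D'.
  by near: alpha; apply: near_left1_powR_small => //;
    rewrite divr_gt0// subr_gt0.
rewrite -yp lee_fin.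
have T0 : 0 <= q `^ (- q^-1) * (c * a) + (alpha * q) `^ (- q^-1) * D
  * (1 - alpha) `^ q^-1.
  apply: addr_ge0; apply: mulr_ge0 => //.
  - exact: powR_ge0.
  - by apply: mulr_ge0; apply: ltW => //; apply: lt_trans c1.
  - by apply: mulr_ge0 => //; exact: powR_ge0.
  - exact: powR_ge0.
rewrite ge0_ler_powR ?nnegrE ?(ltW p0) ?(ltW y0)//.
have -> : q `^ (- q^-1) * (c * a) = c * (a * Q) by rewrite -/Q; ring.
rewrite addrC -lerBrDr; apply: le_trans (_ : D' * (1 - alpha) `^ q^-1 <= _);
  last first.
  by rewrite mulrC -ler_pdivlMr// ltW.
rewrite ler_wpM2r ?powR_ge0// /D';
  apply: (@le_trans _ _ ((2^-1 * q) `^ (- q^-1) * D)).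
  rewrite ler_wpM2r// !powRN lef_pV2 ?posrE ?powR_gt0 ?mulr_gt0// ?invr_gt0//.
  rewrite ge0_ler_powR ?nnegrE ?invr_ge0 ?(ltW q0) ?mulr_ge0 ?invr_ge0
    ?(ltW al00) ?(ltW q0)//.
  by rewrite ler_wpM2r ?(ltW al0)// ltW.
by rewrite lerDl.
Unshelve. all: by end_near. Qed.

End asymptotics.

Theorem theorem3p1 (R : realType) (n : nat) (p q : R) (G : set 'rV[R]_n) :
  (2 <= n)%N -> 1 <= p -> p < n%:R -> 1 <= q -> open G ->
  (((1 - alpha) `^ (p / q))%:E * capB alpha p q G)%E @[alpha --> 1^'-] -->
    (((1 / q) `^ (p / q))%:E * capW p G)%E.
Proof.
move=> _ p1 pn q1 oG; rewrite div1r.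
have q0 : 0 < q by exact: lt_le_trans q1.
have Q0 : 0 < q^-1 `^ (p / q) by rewrite powR_gt0// invr_gt0.
have := cap_open_ge0 p (sobolev_seminorm p) G; rewrite -/(capW p G).
case E : (capW p G) => [w| |]// w0; last first.
  rewrite gt0_muley ?lte_fin//; apply/cvgeyPgt => A.
  by apply: capB_eventually_gt => //; rewrite E gt0_muley ?lte_fin// ltry.
rewrite -EFinM; set l := _ * w.
have Hle := @capB_eventually_le R n p q G p1 q1 w.
have Hgt (e : R) : 0 < e -> \forall alpha \near 1^'-,
    ((l - e)%:E < ((1 - alpha) `^ (p / q))%:E * capB alpha p q G)%E.
  move=> e0; apply: capB_eventually_gt => //.
  by rewrite E -EFinM lte_fin ltrBlDr ltrDl.
have X0 alpha : (0 <= ((1 - alpha) `^ (p / q))%:E * capB alpha p q G)%E.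
  by rewrite mule_ge0 ?lee_fin ?powR_ge0// cap_open_ge0.
apply/fine_cvgP; split.
  near=> alpha.
  have : (((1 - alpha) `^ (p / q))%:E * capB alpha p q G <= (l + 1)%:E)%E.
    by near: alpha; exact: Hle.
  by move=> h; rewrite ge0_fin_numE// (le_lt_trans h)// ltry.
apply/cvgrPdist_le => e e0; near=> alpha => /=.
have h1 : (((1 - alpha) `^ (p / q))%:E * capB alpha p q G <= (l + e)%:E)%E.
  by near: alpha; exact: Hle.
have h2 : ((l - e)%:E < ((1 - alpha) `^ (p / q))%:E * capB alpha p q G)%E.
  by near: alpha; exact: Hgt.
move: h1 h2 (X0 alpha).
case: (_ * capB alpha p q G)%E => [x| |]//; rewrite !lee_fin lte_fin =>
  h1 h2 _ /=.
by rewrite ler_distlC; apply/andP; split => //; exact: ltW.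
Unshelve. all: by end_near. Qed.
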